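(* Let $\psi,\phi:[0,1]\to\mathrm{Sp}(\mathbb{R}^{2n},\Omega_0)$ be two continuous paths of symplectic matrices and define $\psi'=\phi\psi\phi^{-1}$, i.e. $\psi'_t=\phi_t\psi_t\phi_t^{-1}$. Then $$\mu_{RS}(\psi')=\mu_{RS}(\psi).$$
   Context: $\mathrm{Sp}(\mathbb{R}^{2n},\Omega_0)=\{A : A^\tau\Omega_0A=\Omega_0\}$ with $\Omega_0=\begin{pmatrix}0&\mathrm{Id}\\-\mathrm{Id}&0\end{pmatrix}$. $\mathrm{Sign}$ of a symmetric form is the number of positive minus the number of negative eigenvalues. Robbin-Salamon index of a path of Lagrangians. Let $(E,\omega)$ be a symplectic vector space of dimension $2m$, and $\mathcal{L}_m$ its space of Lagrangian subspaces. For a smooth curve $\Lambda:[a,b]\to\mathcal{L}_m$ and $t_0\in[a,b]$, choose a Lagrangian complement $W$ of $\Lambda_{t_0}$; for $t$ near $t_0$, $\Lambda_t=\{v+\alpha_t(v): v\in\Lambda_{t_0}\}$ with $\alpha_t:\Lambda_{t_0}\to W$ linear, and $Q(\Lambda_{t_0},\dot\Lambda_{t_0})(v,v')=\frac{d}{dt}\big|_{t_0}\omega(v,\alpha_t(v'))$, a symmetric bilinear form on $\Lambda_{t_0}$ independent of $W$. Fix a reference Lagrangian $V$. A crossing is a $t$ with $\Lambda_t\cap V\ne\{0\}$; its crossing form is $\Gamma(\Lambda,V,t)=Q(\Lambda_t,\dot\Lambda_t)|_{\Lambda_t\cap V}$, and the crossing is regular if this form is nondegenerate. If $\Lambda$ has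 only regular crossings, $\mu_{RS}(\Lambda,V)=\frac12\mathrm{Sign}\,\Gamma(\Lambda,V,a)+\sum_{a<t<b,\ t\text{ crossing}}\mathrm{Sign}\,\Gamma(\Lambda,V,t)+\frac12\mathrm{Sign}\,\Gamma(\Lambda,V,b)$ (an end term is $0$ if the endpoint is not a crossing). For a continuous path, $\mu_{RS}(\Lambda,V)$ is the value on any smooth path with only regular crossings homotopic to $\Lambda$ with fixed endpoints (Robbin and Salamon: such paths exist and the value does not depend on the choice). Robbin-Salamon index of a continuous path $\psi:[0,1]\to\mathrm{Sp}(\mathbb{R}^{2n},\Omega_0)$: $\mu_{RS}(\psi):=\mu_{RS}(\mathrm{Gr}\,\psi,\Delta)$, computed in $(\mathbb{R}^{2n}\times\mathbb{R}^{2n},\overline\Omega=-\Omega_0\oplus\Omega_0)$, with $\mathrm{Gr}\,\psi_t=\{(x,\psi_tx)\}$ and $\Delta=\{(x,x)\}$. *)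

(* Defs.v *)
From HB Require Import structures.
From mathcomp Require Import all_boot all_order all_algebra.
From mathcomp Require Import all_classical all_reals all_analysis.

Set Implicit Arguments.
Unset Strict Implicit.
Unset Printing Implicit Defensive.

Import Order.TTheory GRing.Theory Num.Theory.
Import numFieldNormedType.Exports.
Local Open Scope classical_set_scope.
Local Open Scope ring_scope.

Section SymplecticVectorSpace.
Context {R : realType} {E : vectType R}.

Record symplectic_form := SymplecticForm {
  sform :> E -> E -> R ;
  sformP : forall v (a : R) x y, sform v (a *: x + y) = a * sform v x + sform v y ;
  sformC : forall u v, sform u v = - sform v u ;
  sform_nondeg : forall u, (forall v, sform u v = 0) -> u = 0
}.

Definition lagrangian (w : symplectic_form) (L : {vspace E}) : Prop :=
  (\dim L).*2 = \dim {: E} /\ {in L &, forall u v, w u v = 0}.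

Definition lagrangian_complement w (L W : {vspace E}) : Prop :=
  [/\ lagrangian w W, (L :&: W)%VS = 0%VS & (L + W)%VS = fullv].

(* [al] is the coordinate of the map [F] in the chart of the Lagrangian
   Grassmannian consisting of the graphs of the linear maps [F x0 -> W]; only
   the values of the endomorphisms [al x] on the subspace [F x0] matter, and
   [F] need only make sense on [A]. *)
Definition chart_at {X : topologicalType} w (A : set X) (F : X -> {vspace E})
    (x0 : X) (W : {vspace E}) (al : X -> 'End(E)) : Prop :=
  lagrangian_complement w (F x0) W /\
  \forall x \near within A (nbhs x0),
    (al x @: F x0 <= W)%VS /\ F x = ((\1 + al x) @: F x0)%VS.

(* The topology and the smooth structure of the finite-dimensional real space
   [E] are those given by its linear forms. *)
Definition lagr_continuous {X : topologicalType} w (A : set X)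
    (F : X -> {vspace E}) : Prop :=
  forall x0, A x0 -> lagrangian w (F x0) /\
    exists W al, chart_at w A F x0 W al /\
      forall v (f : 'Hom(E, R^o)), v \in F x0 ->
        f (al x v) @[x --> within A (nbhs x0)] --> f (al x0 v).

Definition smooth_near (f : R -> R) (t0 : R) : Prop :=
  \forall t \near t0, forall k, derivable (derive1n k f) t 1.

(* The coordinate [al] is smooth on a full neighbourhood of [t0] in the line; when
   [t0] is an endpoint of [[a, b]] it is a smooth extension of the coordinate of
   the curve, and its derivative at [t0] is the one-sided derivative of the
   curve. *)
Definition smooth_chart_at w (a b : R) (La : R -> {vspace E}) (t0 : R)
    (W : {vspace E}) (al : R -> 'End(E)) : Prop :=
  chart_at w `[a, b] La t0 W al /\
  forall v (f : 'Hom(E, R^o)), v \in La t0 ->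
    smooth_near (fun t => f (al t v)) t0.

Definition lagr_smooth w (a b : R) (La : R -> {vspace E}) : Prop :=
  forall t0, t0 \in `[a, b] -> lagrangian w (La t0) /\
    exists W al, smooth_chart_at w a b La t0 W al.

(* The form Q(La_t0, dLa/dt_t0), computed in an arbitrarily chosen chart. Only
   its restriction to [La t0] is meaningful: that restriction does not depend on
   the chart. *)
Definition Qform w (a b : R) (La : R -> {vspace E}) (t0 : R) : E -> E -> R :=
  xget (fun _ _ => 0)
    [set q | exists W al, smooth_chart_at w a b La t0 W al /\
       q = fun v v' => derive1 (fun t => w v (al t v')) t0].

(* Eigenvalues of a form are those of its Gram matrix in a basis; by Sylvester's
   law of inertia, the number of each sign does not depend on the basis. *)
Definition gram (U : {vspace E}) (q : E -> E -> R) : 'M[R]_(\dim U) :=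
  \matrix_(i, j) q (tnth (vbasis U) i) (tnth (vbasis U) j).

(* Eigenvalues are counted with multiplicity. *)
Definition nb_eigenvalues (n : nat) (M : 'M[R]_n) (P : set R) : nat :=
  (\sum_(x \in P) mup x (char_poly M))%N.

Definition Sign (U : {vspace E}) (q : E -> E -> R) : int :=
  (nb_eigenvalues (gram U q) [set x | 0 < x])%:Z -
  (nb_eigenvalues (gram U q) [set x | x < 0])%:Z.

Definition nondegenerate_on (U : {vspace E}) (q : E -> E -> R) : Prop :=
  forall v, v \in U -> (forall v', v' \in U -> q v v' = 0) -> v = 0.

Definition crossing (La : R -> {vspace E}) (V : {vspace E}) (t : R) : Prop :=
  (La t :&: V)%VS != 0%VS.

Definition regular_crossings w (a b : R) La V : Prop :=
  forall t, t \in `[a, b] -> crossing La V t ->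
    nondegenerate_on (La t :&: V) (Qform w a b La t).

(* [Sign (La t :&: V) _] is [0] when [t] is not a crossing. The sum over the
   interior crossings is finite when all the crossings are regular. *)
Definition RS_regular w (a b : R) La V : R :=
  let G t : R := (Sign (La t :&: V) (Qform w a b La t))%:~R in
  2^-1 * G a + \sum_(t \in [set t | a < t < b /\ crossing La V t]) G t
  + 2^-1 * G b.

Definition lagr_homotopic w (a b : R) (La La' : R -> {vspace E}) : Prop :=
  exists H : R * R -> {vspace E},
    [/\ lagr_continuous w (`[(0 : R), 1] `*` `[a, b]) H,
        forall t, t \in `[a, b] -> H (0, t) = La t,
        forall t, t \in `[a, b] -> H (1, t) = La' t,
        forall s, s \in `[0, 1] -> H (s, a) = La a &
        forall s, s \in `[0, 1] -> H (s, b) = La b].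

(* Every continuous path is homotopic to a smooth one with regular crossings, all
   of which give the same value: [xget] returns this common value. *)
Definition muRS_lagr w (a b : R) (La : R -> {vspace E}) (V : {vspace E}) : R :=
  xget 0 [set mu | exists La', [/\ lagr_smooth w a b La',
    regular_crossings w a b La' V, lagr_homotopic w a b La La' &
    mu = RS_regular w a b La' V]].

End SymplecticVectorSpace.
Arguments symplectic_form {R} E.

Section SymplecticMatrices.
Context {R : realType} (n : nat).

Definition Omega0 : 'M[R]_(n + n) := block_mx 0 1%:M (- 1%:M) 0.

Definition Omega0_form (x y : 'cV[R]_(n + n)) : R := (x^T *m Omega0 *m y) 0 0.

Definition Sp : set 'M[R]_(n + n) := [set A | A^T *m Omega0 *m A = Omega0].

Definition Omegabar_fun (u v : 'cV[R]_(n + n) * 'cV[R]_(n + n)) : R :=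
  - Omega0_form u.1 v.1 + Omega0_form u.2 v.2.

Lemma Omega0_formP v (a : R) x y :
  Omega0_form v (a *: x + y) = a * Omega0_form v x + Omega0_form v y.
Proof. by rewrite /Omega0_form mulmxDr -scalemxAr !mxE. Qed.

Lemma trmx_Omega0 : Omega0^T = - Omega0.
Proof.
rewrite /Omega0 tr_block_mx opp_block_mx !trmx0 raddfN /= trmx1.
by rewrite opprK oppr0.
Qed.

Lemma Omega0_formC x y : Omega0_form x y = - Omega0_form y x.
Proof.
have -> : Omega0_form x y = ((x^T *m Omega0 *m y)^T) 0 0 by rewrite [RHS]mxE.
rewrite !trmx_mul trmxK trmx_Omega0 /Omega0_form mulNmx mulmxN mulmxA.
by rewrite mxE.
Qed.

Lemma Omega0_form_nondeg x : (forall y, Omega0_form x y = 0) -> x = 0.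
Proof.
move=> x0; have xO0 : x^T *m Omega0 = 0.
  apply/rowP => j; have := x0 (delta_mx j 0).
  by rewrite /Omega0_form -colE !mxE.
move: xO0; rewrite -[x]vsubmxK tr_col_mx /Omega0 mul_row_block.
rewrite !mulmx0 !mulmxN !mulmx1 add0r addr0 -row_mx0 => /eq_row_mx [xd xu].
have {}xd : dsubmx x = 0.
  by apply: trmx_inj; rewrite trmx0 -[LHS]opprK xd oppr0.
have {}xu : usubmx x = 0 by apply: trmx_inj; rewrite trmx0.
by rewrite xd xu col_mx0.
Qed.

Lemma Omegabar_funP v (a : R) x y :
  Omegabar_fun v (a *: x + y) = a * Omegabar_fun v x + Omegabar_fun v y.
Proof.
by rewrite /Omegabar_fun /= !Omega0_formP opprD mulrDr mulrN addrACA.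
Qed.

Lemma Omegabar_funC u v : Omegabar_fun u v = - Omegabar_fun v u.
Proof.
rewrite /Omegabar_fun opprD opprK (Omega0_formC u.1).
by rewrite (Omega0_formC u.2) opprK.
Qed.

Lemma Omegabar_fun_nondeg u : (forall v, Omegabar_fun u v = 0) -> u = 0.
Proof.
have O0 x : Omega0_form x 0 = 0 by rewrite /Omega0_form mulmx0 mxE.
case: u => u1 u2 u0; congr pair; apply: Omega0_form_nondeg => y.
  have := u0 (y, 0); rewrite /Omegabar_fun /= O0 addr0 => /eqP.
  by rewrite oppr_eq0 => /eqP.
by have := u0 (0, y); rewrite /Omegabar_fun /= O0 oppr0 add0r.
Qed.

Definition Omegabar : symplectic_form ('cV[R]_(n + n) * 'cV[R]_(n + n))%type :=
  SymplecticForm Omegabar_funP Omegabar_funC Omegabar_fun_nondeg.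

Definition Gr (A : 'M[R]_(n + n)) :
    {vspace 'cV[R]_(n + n) * 'cV[R]_(n + n)} :=
  limg (linfun (fun x : 'cV[R]_(n + n) => (x, A *m x))).

Definition Delta : {vspace 'cV[R]_(n + n) * 'cV[R]_(n + n)} :=
  limg (linfun (fun x : 'cV[R]_(n + n) => (x, x))).

Definition muRS (psi : R -> 'M[R]_(n + n)) : R :=
  muRS_lagr Omegabar 0 1 (fun t => Gr (psi t)) Delta.

Definition Sp_path (psi : R -> 'M[R]_(n + n)) : Prop :=
  {within `[0, 1], continuous psi} /\ forall t, t \in `[0, 1] -> Sp (psi t).

End SymplecticMatrices.

(* Main.v *)
From HB Require Import structures.
Require Import Defs.
From mathcomp Require Import all_boot all_order all_algebra.
From mathcomp Require Import all_classical all_reals all_analysis.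
From mathcomp Require Import spectral complex ring lra.

(** [muRS] selects an element of the set of all values of the index on smooth
    representatives with regular crossings, so two paths with the same set of
    values have the same index. Write [RS_values] for the set. Since conjugation
    by [phi] is undone by conjugation by [phi^-1], it is enough to show that
    every value for [psi] is a value for [phi psi phi^-1].

    The graph of [phi_t psi_t phi_t^-1] is the image of the graph of [psi_t]
    under the map [phi_t x phi_t], which is symplectic for [-Omega0 + Omega0]
    and preserves the diagonal. If [phi] is replaced by a smooth path [chi]
    homotopic to it in the symplectic group with fixed endpoints, then, for a
    smooth regular representative [La'] of the graph of [psi], the curve
    [(chi_t x chi_t) La'_t] is a smooth representative of the graph of
    [phi psi phi^-1] ([chart_transport] handles charts, [RS_values_transport]
    the homotopy). It has the same crossings as [La'], and [chi_t x chi_t] carries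
    the crossing forms of [La'] to its own: the derivative of [chi] only
    contributes the value of the form at two vectors of the diagonal, which is
    Lagrangian ([derive_moved_crossing_form]). By
    Sylvester's law of inertia ([real_inertia_le], [Sign_transport]) the
    signatures agree, hence so do the indices.

    It remains to find [chi]. The property to prove is stable under products
    of paths ([transports_valuesM]), which avoids smoothing [phi] globally: a
    path in the symplectic group that starts at the identity and stays close to
    it is, by the Cayley transform, a path in the vector space of Hamiltonian
    matrices, which contracts linearly to a segment
    ([transports_values_near1]). A path [phi] stopped at time [c'] is the
    product of such a path with [phi] stopped at a slightly earlier time [c],
    and a supremum argument reaches time [1] ([transports_values_path]). *)

Set Implicit Arguments.
Unset Strict Implicit.
Unset Printing Implicit Defensive.

Import Order.TTheory GRing.Theory Num.Theory.
Import numFieldNormedType.Exports VectorInternalTheory.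
Local Open Scope ring_scope.

(** * Sylvester's law of inertia for eigenvalue counts *)

Section Inertia.
Local Open Scope sesquilinear_scope.
Variable C : numClosedFieldType.

Lemma hermitian_form_diag n (P : 'M[C]_n) (d z : 'rV[C]_n) :
  P \is unitarymx ->
  ((z *m P) *m (P^t* *m diag_mx d *m P) *m (z *m P)^t*) 0 0 =
  \sum_i `|z 0 i| ^+ 2 * d 0 i.
Proof.
move=> PU; rewrite trmx_mul map_mxM !mulmxA mulmxtVK // mulmxtVK //.
rewrite mxE; apply: eq_bigr => i _; rewrite mul_mx_diag !mxE normCK.
by rewrite mulrAC.
Qed.

Definition nb_pos n (d : 'rV[C]_n) := #|[set i | 0 < d 0 i]|.

(** A dimension count. If [B] had more positive eigenvalues than [A], some
    nonzero vector in the sum of the positive eigenspaces of [B] would be sent by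
    [Q] into the sum of the nonpositive eigenspaces of [A]; the common value of
    the two forms there would be both positive and nonpositive. *)
Lemma inertia_le m n (A PA : 'M[C]_n) (B PB : 'M[C]_m) (Q : 'M[C]_(m, n))
    (dA : 'rV[C]_n) (dB : 'rV[C]_m) :
  PA \is unitarymx -> PB \is unitarymx -> dA \is a realmx ->
  A = PA^t* *m diag_mx dA *m PA -> B = PB^t* *m diag_mx dB *m PB ->
  B = Q *m A *m Q^t* -> (nb_pos dB <= nb_pos dA)%N.
Proof.
move=> PAU PBU dAR AE BE BA; rewrite leqNgt; apply/negP => lt_pos.
pose I := [set i | 0 < dB 0 i]; pose J := [set i | 0 < dA 0 i].
pose N := PB *m Q *m PA^t*.
pose cols p (S : {set 'I_p}) (M : 'M[C]_(m, p)) : 'M[C]_(m, #|S|) :=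
  colsub (enum_val : 'I_#|S| -> 'I_p) M.
have colsP p (S : {set 'I_p}) (M : 'M[C]_(m, p)) (z : 'rV_m) :
    z *m cols p S M = 0 -> forall i, i \in S -> (z *m M) 0 i = 0.
  rewrite /cols mulmx_colsub => /rowP zM i iS.
  by have := zM (enum_rank_in iS i); rewrite !mxE enum_rankK_in.
(* Row vectors [z] of coordinates in the eigenbasis [PB]: the first block of
   equations kills the nonpositive directions of [B], the second one the
   positive directions of [A]; there are fewer than [m] equations. *)
have : kermx (row_mx (cols _ (~: I) 1%:M) (cols _ J N)) != 0.
  rewrite -mxrank_eq0 mxrank_ker -lt0n subn_gt0.
  rewrite (leq_ltn_trans (rank_leq_col _)) // -[X in (_ < X)%N](card_ord m).
  by rewrite -(cardsC I) addnC ltn_add2r.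
move=> /rowV0Pn[z /sub_kermxP]; rewrite mul_mx_row -[0]row_mx0.
move=> /eq_row_mx[/colsP zI /colsP zJ] z0.
have zI0 i : i \notin I -> z 0 i = 0.
  by move=> iI; have := zI i; rewrite mulmx1 inE iI; apply.
have pos : 0 < \sum_i `|z 0 i| ^+ 2 * dB 0 i.
  have ge0 i : 0 <= `|z 0 i| ^+ 2 * dB 0 i.
    have [|/zI0 ->] := boolP (i \in I); last by rewrite normr0 expr0n mul0r.
    by rewrite inE => /ltW; apply: mulr_ge0; rewrite exprn_ge0.
  rewrite lt0r sumr_ge0 // andbT; apply: contra z0.
  rewrite psumr_eq0 // => /allP zz; apply/eqP/rowP => i; rewrite mxE.
  have [iI|/zI0 //] := boolP (i \in I); have := zz i (mem_index_enum _).
  move: iI; rewrite inE /= mulf_eq0 expf_eq0 normr_eq0 /=.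
  by move=> /gt_eqF -> /[!orbF] /eqP.
have neg : \sum_i `|(z *m N) 0 i| ^+ 2 * dA 0 i <= 0.
  apply: sumr_le0 => i _; have [/zJ ->|] := boolP (i \in J).
    by rewrite normr0 expr0n mul0r.
  rewrite inE -real_leNgt ?real0 ?(mxOverP dAR) // => dA0.
  by rewrite mulr_ge0_le0 // exprn_ge0.
suff EE : \sum_i `|z 0 i| ^+ 2 * dB 0 i = \sum_i `|(z *m N) 0 i| ^+ 2 * dA 0 i.
  by move: pos; rewrite EE => pos; have := lt_le_trans pos neg; rewrite ltxx.
rewrite -(hermitian_form_diag _ _ PBU) -(hermitian_form_diag _ _ PAU) -AE -BE BA.
have -> : z *m N *m PA = z *m PB *m Q.
  by rewrite /N !mulmxA mulmxKtV.
by rewrite [in RHS]trmx_mul [in RHS]map_mxM !mulmxA; reflexivity.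
Qed.

End Inertia.

Lemma char_poly_conjmx (F : fieldType) n (P D : 'M[F]_n) :
  P \in unitmx -> char_poly (invmx P *m D *m P) = char_poly D.
Proof.
move=> Pu; rewrite /char_poly.
have Pinv : map_mx polyC (invmx P) *m map_mx polyC P = 1%:M by rewrite -map_mxM mulVmx // map_mx1.
have -> : char_poly_mx (invmx P *m D *m P) =
    map_mx polyC (invmx P) *m char_poly_mx D *m map_mx polyC P.
  rewrite /char_poly_mx mulmxBr mulmxBl -!map_mxM; congr (_ - _).
  by rewrite scalar_mxC -mulmxA Pinv mulmx1.
by rewrite !det_mulmx mulrAC -det_mulmx Pinv det1 mul1r.
Qed.

Section RealSymmetric.
Local Open Scope sesquilinear_scope.
Variable R : realType.
Let toC := @real_complex_def R (Phant R).

(** The spectral theorem is applied over the complex numbers, where a real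
    symmetric matrix is Hermitian: only [P] is complex, and the factorization of
    the characteristic polynomial descends to the reals. *)
Lemma real_spectral n (A : 'M[R]_n) : A^T = A ->
  exists (P : 'M[R[i]]_n) (d : 'rV[R]_n),
    [/\ P \is unitarymx,
        map_mx toC A = P^t* *m diag_mx (map_mx toC d) *m P &
        char_poly A = \prod_(i < n) ('X - (d 0 i)%:P)].
Proof.
move=> AT; set AC := map_mx toC A.
have AR : AC \is a realmx.
  by apply/mxOverP => i j; rewrite mxE; apply/CrealP; exact: conjc_real.
have AH : AC \is hermsymmx.
  apply: realsym_hermsym => //; apply/is_hermitianmxP.
  by rewrite expr0 scale1r; apply/matrixP => i j; rewrite !mxE -{1}AT mxE.
have /mxOverP dR := hermitian_spectral_diag_real AH.
have := hermitian_normalmx AH => /orthomx_spectralP.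
set P := spectralmx AC; set dC := spectral_diag AC => AE.
have PU : P \is unitarymx by exact: spectral_unitarymx.
pose d := map_mx (@complex.Re R) dC.
have dE : map_mx toC d = dC.
  by apply/rowP => i; rewrite !mxE; exact: RRe_real (dR 0 i).
exists P, d; split=> //.
  by rewrite dE -invmx_unitary.
apply: (map_poly_inj toC); rewrite map_char_poly -/AC AE.
rewrite char_poly_conjmx ?spectral_unit // char_poly_trig ?diag_mx_is_trig //.
rewrite rmorph_prod; apply: eq_bigr => i _.
by rewrite rmorphB /= map_polyX map_polyC /= -dE !mxE eqxx mulr1n.
Qed.

Lemma nb_eigenvalues_card n (M : 'M[R]_n) (d : 'rV[R]_n) (S : set R) :
  char_poly M = \prod_(i < n) ('X - (d 0 i)%:P) ->
  nb_eigenvalues M S = #|[set i | `[< S (d 0 i) >]]|.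
Proof.
move=> ME; pose v i := d 0 i; pose s := [seq v i | i <- enum 'I_n].
have mupE x : mup x (char_poly M) = (\sum_(i < n) (v i == x))%N.
  have -> : char_poly M = \prod_(y <- s) ('X - y%:P).
    by rewrite ME big_map big_enum.
  rewrite mu_prod_XsubC -sum1_count big_map big_mkcond big_enum.
  by apply: eq_big => // i _ /=; rewrite eq_sym; case: eqP.
pose r := undup [seq x <- s | `[< S x >]].
rewrite /nb_eigenvalues (@fsbigE _ _ _ _ _ r) ?undup_uniq //; first last.
- move=> x Sx xr; rewrite mupE big1 // => i _; apply/eqP; rewrite eqb0.
  apply: contra xr => /eqP vix; rewrite mem_undup mem_filter asboolT //=.
  by rewrite -vix map_f ?mem_enum.
- by move=> x /=; rewrite mem_undup mem_filter => /andP[/asboolP].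
rewrite big_mkcond [LHS]big_seq -sum1_card [RHS]big_mkcond.
rewrite (eq_bigr (fun x => \sum_(i < n) (v i == x))%N); last first.
  move=> x; rewrite mem_undup mem_filter => /andP[Sx _].
  by rewrite mem_set ?mupE //; exact/asboolP.
rewrite -big_seq exchange_big; apply: eq_bigr => i _ /=.
have -> : (\sum_(x <- r) (v i == x))%N = count_mem (v i) r.
  by rewrite -sumn_count sumnE big_map; apply: eq_bigr => x _; rewrite eq_sym.
rewrite count_uniq_mem ?undup_uniq // mem_undup mem_filter map_f ?mem_enum //.
by rewrite andbT inE; case: asboolP.
Qed.

(** The law of inertia as an inequality for a rectangular [Q], so as to compare
    forms on spaces whose dimensions are not yet known to agree. The negative
    eigenvalues are the positive ones of the opposite form. *)
Lemma real_inertia_le m n (A : 'M[R]_n) (B : 'M[R]_m) (Q : 'M[R]_(m, n)) :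
  A^T = A -> B = Q *m A *m Q^T ->
  (nb_eigenvalues B [set x | (0 < x)%R]%classic <=
     nb_eigenvalues A [set x | (0 < x)%R]%classic)%N /\
  (nb_eigenvalues B [set x | (x < 0)%R]%classic <=
     nb_eigenvalues A [set x | (x < 0)%R]%classic)%N.
Proof.
move=> AT BE; have BT : B^T = B by rewrite BE !trmx_mul trmxK AT mulmxA.
have [PA [dA [PAU AE cA]]] := real_spectral AT.
have [PB [dB [PBU BE' cB]]] := real_spectral BT.
have toCR p q (M : 'M[R]_(p, q)) : map_mx toC M \is a realmx.
  by apply/mxOverP => i j; rewrite mxE; apply/CrealP; exact: conjc_real.
have BC : map_mx toC B = map_mx toC Q *m map_mx toC A *m (map_mx toC Q)^t*.
  rewrite BE !map_mxM; congr (_ *m _ *m _).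
  by apply/matrixP => i j; rewrite !mxE; symmetry; exact: conjc_real.
rewrite !(nb_eigenvalues_card _ cA) !(nb_eigenvalues_card _ cB); split.
  have := inertia_le PAU PBU (toCR _ _ dA) AE BE' BC.
  have posE p (d : 'rV[R]_p) : [set i | 0 < map_mx toC d 0 i] =
      [set i | `[< 0 < d 0 i >]].
    by apply/setP => i; rewrite !inE mxE ltcR asboolb.
  by rewrite /nb_pos !posE.
have sgn p (P : 'M[R[i]]_p) (d : 'rV[R]_p) M :
    M = P^t* *m diag_mx (map_mx toC d) *m P ->
    - M = P^t* *m diag_mx (map_mx toC (- d)) *m P.
  by move=> ->; rewrite map_mxN raddfN mulmxN mulNmx.
have BCN : - map_mx toC B = map_mx toC Q *m (- map_mx toC A) *m (map_mx toC Q)^t*.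
  by rewrite BC mulmxN mulNmx.
have := inertia_le PAU PBU (toCR _ _ (- dA)) (sgn _ _ _ _ AE) (sgn _ _ _ _ BE') BCN.
have negE p (d : 'rV[R]_p) : [set i | 0 < map_mx toC (- d) 0 i] =
    [set i | `[< d 0 i < 0 >]].
  by apply/setP => i; rewrite !inE !mxE ltcR oppr_gt0 asboolb.
by rewrite /nb_pos !negE.
Qed.

End RealSymmetric.

Local Open Scope classical_set_scope.
Local Open Scope ring_scope.

(** * Smooth functions on an open set form an algebra closed under inverses *)

Section Smooth.
Variable R : realType.
Implicit Types (f g : R -> R) (U : set R).

Definition smooth_on U f :=
  forall t, U t -> forall k, derivable (derive1n k f) t 1.

(** The expressions built from smooth functions by the operations below.
    Smoothness is proved for all of them at once, because this class, unlike any
    single product or quotient, is closed under differentiation; this replaces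
    formulas of Leibniz type for the higher derivatives. *)
Inductive smooth_alg U : (R -> R) -> Prop :=
| SmoothBase f : smooth_on U f -> smooth_alg U f
| SmoothCst c : smooth_alg U (fun=> c)
| SmoothAdd f g : smooth_alg U f -> smooth_alg U g ->
    smooth_alg U (fun t => f t + g t)
| SmoothMul f g : smooth_alg U f -> smooth_alg U g ->
    smooth_alg U (fun t => f t * g t)
| SmoothInv f : smooth_alg U f -> (forall t, U t -> f t != 0) ->
    smooth_alg U (fun t => (f t)^-1).

Lemma smooth_alg_derive U f : smooth_alg U f ->
  exists2 g, smooth_alg U g & forall t, U t -> is_derive t 1 f (g t).
Proof.
elim=> {f} [f fU | c | f g _ [f' f'U df] _ [g' g'U dg] |
            f g fU [f' f'U df] gU [g' g'U dg] | f fU [f' f'U df] f0].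
- exists (derive1 f).
    by apply: SmoothBase => t Ut k; rewrite /derive1n -iterSr; exact: (fU t Ut k.+1).
  by move=> t Ut; rewrite derive1E; apply: derivableP; exact: (fU t Ut 0%N).
- by exists (fun=> 0); [exact: SmoothCst | move=> t _; exact: is_derive_cst].
- by exists (fun t => f' t + g' t); [exact: SmoothAdd | move=> t Ut;
    exact: (is_deriveD (df t Ut) (dg t Ut))].
- exists (fun t => f t * g' t + g t * f' t); first by do 2?constructor.
  by move=> t Ut; exact: (is_deriveM (df t Ut) (dg t Ut)).
- exists (fun t => -1 * ((f t)^-1 * (f t)^-1) * f' t).
    apply: SmoothMul => //; apply: SmoothMul; first exact: SmoothCst.
    by apply: SmoothMul; exact: SmoothInv.
  move=> t Ut; have := is_deriveV (f0 t Ut) (df t Ut).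
  by rewrite /GRing.scale /= mulN1r -exprVn expr2.
Qed.

Lemma smooth_alg_on U f : open U -> smooth_alg U f -> smooth_on U f.
Proof.
move=> Uo fU; have key k : exists2 g, smooth_alg U g &
    forall t, U t -> derive1n k f t = g t.
  elim: k => [|k [g gU gE]]; first by exists f.
  have [g' g'U dg] := smooth_alg_derive gU; exists g' => // t Ut.
  rewrite derive1nS derive1E -(@derive_val _ _ _ _ _ _ _ (dg t Ut)).
  apply: near_eq_derive.
  by near do [rewrite gE//]; exact: open_nbhs_nbhs.
move=> t Ut k; have [g gU gE] := key k.
have [g' g'U dg] := smooth_alg_derive gU.
have := @ex_derive _ _ _ _ _ _ _ (dg t Ut).
apply: near_eq_derivable.
by near do [rewrite gE//]; exact: open_nbhs_nbhs.
Unshelve. all: by end_near. Qed.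

End Smooth.

(** * Regular families of scalars, matrices and linear maps *)

(** The chart computations below are the same for continuity relative to a set
    and for smoothness at a point: rational operations, and the fact that a
    quantity nonzero at [x0] remains so along [F]. This record isolates what
    they use. *)
Record regular_class (R : realType) (X : Type) (F : set_system X) (x0 : X)
    (reg : (X -> R) -> Prop) : Prop := RegularClass {
  reg_cst : forall c, reg (fun=> c) ;
  regD : forall f g, reg f -> reg g -> reg (fun x => f x + g x) ;
  regM : forall f g, reg f -> reg g -> reg (fun x => f x * g x) ;
  regV : forall f, reg f -> f x0 != 0 -> reg (fun x => (f x)^-1) ;
  reg_cvg : forall f, reg f -> f x @[x --> F] --> f x0 }.

Lemma regular_continuous (R : realType) (X : topologicalType) (A : set X)
    (x0 : X) :
  A x0 ->
  regular_class (within A (nbhs x0)) x0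
    (fun f : X -> R => f x @[x --> within A (nbhs x0)] --> f x0).
Proof.
move=> Ax0; split=> //.
- by move=> c; exact: cvg_cst.
- by move=> f g; exact: cvgD.
- by move=> f g; exact: cvgM.
- by move=> f ff f0; exact: cvgV.
Qed.

Lemma smooth_near_continuous (R : realType) (f : R -> R) (t0 : R) :
  smooth_near f t0 -> {for t0, continuous f}.
Proof.
move=> /nbhs_singleton/(_ 0%N) /=.
by move=> /derivable1_diffP/differentiable_continuous.
Qed.

Lemma regular_smooth (R : realType) (A : set R) (t0 : R) :
  regular_class (within A (nbhs t0)) t0 (fun f => smooth_near f t0).
Proof.
(* [P] is the condition under which [f] is an expression in smooth functions; it
   holds on an open neighbourhood of [t0], where such expressions are smooth. *)
have op (P : R -> Prop) f : (\forall t \near t0, P t) ->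
    (forall U, open U -> (forall t, U t -> P t) -> smooth_alg U f) ->
    smooth_near f t0.
  move=> nP; have : nbhs t0 P by []; rewrite nbhsE => -[U [Uo Ut0] UP] fU.
  have := smooth_alg_on Uo (fU U Uo UP).
  have nU : \forall t \near t0, U t by exact: open_nbhs_nbhs.
  by move=> fs; apply: filterS nU => t Ut k; exact: (fs t Ut k).
split.
- move=> c; apply: (op (fun=> True)); first exact: filterT.
  by move=> *; exact: SmoothCst.
- move=> f g fs gs; apply: (op _ _ (filterI fs gs)) => U _ Ufg.
  by apply: SmoothAdd; apply: SmoothBase => t Ut k; have [] := Ufg t Ut.
- move=> f g fs gs; apply: (op _ _ (filterI fs gs)) => U _ Ufg.
  by apply: SmoothMul; apply: SmoothBase => t Ut k; have [] := Ufg t Ut.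
- move=> f fs f0.
  have fn0 : \forall t \near t0, f t != 0.
    have : f t @[t --> t0] --> f t0 by exact: smooth_near_continuous.
    by move/cvgr_neq0; exact.
  apply: (op _ _ (filterI fs fn0)) => U _ Uf.
  by apply: SmoothInv => [|t /Uf[]//]; apply: SmoothBase => t /Uf[].
- move=> f fs; apply: cvg_within_filter.
  exact: (smooth_near_continuous fs).
Qed.

Lemma linfun_linear (R : realType) (E E' : vectType R) (f : E -> E') :
  linear f -> linfun f =1 f.
Proof.
move=> fl; pose g := HB.pack_for {linear E -> E'} f
  (GRing.isLinear.Build _ _ _ _ f fl).
exact: (lfunE g).
Qed.

Section MatrixFamilies.
Variables (R : realType) (X : Type) (F : set_system X) (x0 : X).
Variable reg : (X -> R) -> Prop.
Hypothesis regP : regular_class F x0 reg.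

Definition mreg m n (M : X -> 'M[R]_(m, n)) :=
  forall i j, reg (fun x => M x i j).

Lemma reg_sum (I : Type) (r : seq I) (P : pred I) (f : I -> X -> R) :
  (forall i, reg (f i)) -> reg (fun x => \sum_(i <- r | P i) f i x).
Proof.
move=> fr; rewrite (_ : (fun x => _) = \sum_(i <- r | P i) f i); last first.
  by apply/funext => x; rewrite fct_sumE.
elim/big_ind: _ => // [|g h gr hr]; first exact: (reg_cst regP).
exact: (regD regP).
Qed.

Lemma reg_prod (I : Type) (r : seq I) (f : I -> X -> R) :
  (forall i, reg (f i)) -> reg (fun x => \prod_(i <- r) f i x).
Proof.
move=> fr; elim: r => [|i r IH].
  under [X in reg X]funext do rewrite big_nil; exact: (reg_cst regP).
by under [X in reg X]funext do rewrite big_cons; exact: (regM regP).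
Qed.

Lemma regN (f : X -> R) : reg f -> reg (fun x => - f x).
Proof.
move=> fr; under [X in reg X]funext do rewrite -mulN1r.
by apply: (regM regP) => //; exact: (reg_cst regP).
Qed.

Lemma mreg_cst m n (M : 'M[R]_(m, n)) : mreg (fun=> M).
Proof. by move=> i j; exact: (reg_cst regP). Qed.

Lemma mregD m n (M N : X -> 'M[R]_(m, n)) :
  mreg M -> mreg N -> mreg (fun x => M x + N x).
Proof.
by move=> Mr Nr i j; under [X in reg X]funext do rewrite mxE; exact: (regD regP).
Qed.

Lemma mregM m n p (M : X -> 'M[R]_(m, n)) (N : X -> 'M[R]_(n, p)) :
  mreg M -> mreg N -> mreg (fun x => M x *m N x).
Proof.
move=> Mr Nr i j; under [X in reg X]funext do rewrite mxE.
by apply: reg_sum => k; exact: (regM regP).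
Qed.

Lemma mregZ m n (a : X -> R) (M : X -> 'M[R]_(m, n)) :
  reg a -> mreg M -> mreg (fun x => a x *: M x).
Proof.
by move=> ar Mr i j; under [X in reg X]funext do rewrite mxE; exact: (regM regP).
Qed.

Lemma mregN m n (M : X -> 'M[R]_(m, n)) : mreg M -> mreg (fun x => - M x).
Proof.
by move=> Mr i j; under [X in reg X]funext do rewrite mxE; exact: regN.
Qed.

Lemma reg_det n (M : X -> 'M[R]_n) : mreg M -> reg (fun x => \det (M x)).
Proof.
move=> Mr; apply: reg_sum => s; apply: (regM regP); first exact: (reg_cst regP).
by apply: reg_prod => i; exact: Mr.
Qed.

Lemma mreg_adj n (M : X -> 'M[R]_n) : mreg M -> mreg (fun x => \adj (M x)).
Proof.
move=> Mr i j; under [X in reg X]funext do rewrite mxE.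
apply: (regM regP); first exact: (reg_cst regP).
by apply: reg_det => k l; under [X in reg X]funext do rewrite !mxE; exact: Mr.
Qed.

(** Cramer's formula for the inverse; unlike [invmx] it involves no case
    distinction, so that a family of inverses is visibly regular. *)
Definition cramer n (M : 'M[R]_n) := (\det M)^-1 *: \adj M.

Lemma cramerE n (M : 'M[R]_n) : \det M != 0 -> cramer M = invmx M.
Proof. by move=> M0; rewrite /cramer /invmx unitmxE unitfE M0. Qed.

Lemma mreg_cramer n (M : X -> 'M[R]_n) :
  mreg M -> \det (M x0) != 0 -> mreg (fun x => cramer (M x)).
Proof.
move=> Mr M0; apply: mregZ; last exact: mreg_adj.
by apply: (regV regP) => //; exact: reg_det.
Qed.

Lemma near_reg_neq0 {FF : Filter F} (f : X -> R) :
  reg f -> f x0 != 0 -> \forall x \near F, f x != 0.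
Proof. by move=> /(reg_cvg regP)/cvgr_neq0; exact. Qed.

Definition vreg (E : vectType R) (u : X -> E) :=
  forall f : 'Hom(E, R^o), reg (fun x => f (u x)).

Definition hreg (E E' : vectType R) (T : X -> 'Hom(E, E')) :=
  forall v, vreg (fun x => T x v).

Lemma v2r_delta (E : vectType R) (u : E) :
  u = \sum_i v2r u 0 i *: r2v (delta_mx 0 i).
Proof.
rewrite -{1}(v2rK u) {1}(row_sum_delta (v2r u)) linear_sum /=.
by apply: eq_bigr => i _; rewrite linearZ.
Qed.

Lemma vreg_linear (E : vectType R) (u : X -> E) (f : E -> R^o) :
  linear f -> vreg u -> reg (fun x => f (u x)).
Proof.
move=> fl /(_ (linfun f)).
by under [X in reg X]funext do rewrite (linfun_linear fl).
Qed.

Lemma vreg_coord (E : vectType R) (u : X -> E) :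
  vreg u <-> mreg (fun x => v2r (u x)).
Proof.
split=> [ur i j | ur f].
  rewrite ord1.
  by apply: (@vreg_linear _ _ (fun v => v2r v 0 j)) => // a v w; rewrite linearP !mxE.
under [X in reg X]funext do rewrite (v2r_delta (u _)) linear_sum.
apply: reg_sum => i; under [X in reg X]funext do rewrite linearZ.
by apply: (regM regP); [exact: ur | exact: (reg_cst regP)].
Qed.

Lemma v2r_lfun (E E' : vectType R) (T : 'Hom(E, E')) v :
  v2r (T v) = v2r v *m f2mx T.
Proof. by rewrite unlock /= r2vK. Qed.

(** Regularity is defined by testing against linear forms, which is
    basis-free; this is the passage to entries, where determinants are
    available. *)
Lemma hreg_mx (E E' : vectType R) (T : X -> 'Hom(E, E')) :
  hreg T <-> mreg (fun x => f2mx (T x)).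
Proof.
split=> [Tr i j | Tr v].
  have /vreg_coord/(_ 0 j) := Tr (r2v (delta_mx 0 i)).
  by under [X in reg X -> _]funext do rewrite v2r_lfun r2vK -rowE mxE.
apply/vreg_coord; under [X in mreg X]funext do rewrite v2r_lfun.
by apply: mregM => //; exact: mreg_cst.
Qed.

Lemma vregD (E : vectType R) (u v : X -> E) :
  vreg u -> vreg v -> vreg (fun x => u x + v x).
Proof.
move=> ur vr f; under [X in reg X]funext do rewrite linearD.
by apply: (regD regP); [exact: ur | exact: vr].
Qed.

Lemma vreg_cst (E : vectType R) (u : E) : vreg (fun=> u).
Proof. by move=> f; exact: (reg_cst regP). Qed.

Lemma hreg_cst (E E' : vectType R) (T : 'Hom(E, E')) : hreg (fun=> T).
Proof. by move=> v; exact: vreg_cst. Qed.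

Lemma vreg_app (E E' : vectType R) (T : X -> 'Hom(E, E')) (u : X -> E) :
  hreg T -> vreg u -> vreg (fun x => T x (u x)).
Proof.
move=> /hreg_mx Tr /vreg_coord ur; apply/vreg_coord.
by under [X in mreg X]funext do rewrite v2r_lfun; exact: mregM.
Qed.

Lemma hregM (E E' E'' : vectType R) (T : X -> 'Hom(E', E''))
    (S : X -> 'Hom(E, E')) :
  hreg T -> hreg S -> hreg (fun x => (T x \o S x)%VF).
Proof.
move=> Tr Sr v; under [X in vreg X]funext do rewrite comp_lfunE.
by apply: vreg_app => //; exact: Sr.
Qed.

Lemma hregD (E E' : vectType R) (T S : X -> 'Hom(E, E')) :
  hreg T -> hreg S -> hreg (fun x => T x + S x).
Proof.
move=> Tr Sr v; under [X in vreg X]funext do rewrite add_lfunE.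
by apply: vregD; [exact: Tr | exact: Sr].
Qed.

(** The inverse is given by Cramer's formula in coordinates, hence is regular,
    and it is an inverse as long as the determinant does not vanish. *)
Lemma hreg_inv {FF : Filter F} (E : vectType R) (T : X -> 'End(E)) :
  hreg T -> T x0 = \1%VF ->
  exists2 S : X -> 'End(E), hreg S &
    \forall x \near F, (S x \o T x)%VF = \1%VF.
Proof.
move=> /hreg_mx Tr T0.
have det0 : \det (f2mx (T x0)) != 0.
  have -> : f2mx (T x0) = 1%:M.
    apply/row_matrixP => i; rewrite !rowE -{1}[delta_mx 0 i]r2vK -v2r_lfun.
    by rewrite T0 id_lfunE r2vK mulmx1.
  by rewrite det1 oner_neq0.
exists (fun x => Hom (cramer (f2mx (T x)))).
  by apply/hreg_mx; exact: mreg_cramer.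
move: det0 => /(near_reg_neq0 (reg_det Tr)); apply: filterS => x Tx.
apply/lfunP => v; apply: v2r_inj.
rewrite comp_lfunE v2r_lfun v2r_lfun /= cramerE // id_lfunE.
by rewrite mulmxK // unitmxE unitfE.
Qed.

End MatrixFamilies.

(** * Symplectic maps acting on charts of the Lagrangian Grassmannian *)

Section SymplecticMaps.
Variables (R : realType) (E : vectType R) (w : symplectic_form E).
Implicit Types (L W : {vspace E}) (T : 'End(E)).

Lemma sform_linear u : linear (w u : E -> R^o).
Proof. by move=> a x y; rewrite sformP. Qed.

Lemma sformDr u x y : w u (x + y) = w u x + w u y.
Proof. by rewrite -[x]scale1r sformP mul1r scale1r. Qed.

Lemma sform0r u : w u 0 = 0.
Proof. by apply: (addrI (w u 0)); rewrite -sformDr !addr0. Qed.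

Lemma sformDl u x y : w (x + y) u = w x u + w y u.
Proof. by rewrite sformC sformDr opprD -!sformC. Qed.

Lemma sform0l u : w 0 u = 0.
Proof. by rewrite sformC sform0r oppr0. Qed.

Definition symplectic_map T := forall u v, w (T u) (T v) = w u v.

Lemma symplectic_lker T : symplectic_map T -> lker T == 0%VS.
Proof.
move=> sT; rewrite -subv0; apply/subvP => u; rewrite memv_ker memv0 => /eqP Tu.
by apply/eqP/(@sform_nondeg _ _ w) => v; rewrite -sT Tu sform0l.
Qed.

Lemma dim_limg_lker0 T L : lker T == 0%VS -> \dim (T @: L) = \dim L.
Proof. by move=> /eqP T0; rewrite limg_dim_eq // T0 capv0. Qed.

Lemma lagrangian_limg T L :
  symplectic_map T -> lagrangian w L -> lagrangian w (T @: L).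
Proof.
move=> sT [dL wL]; split; first by rewrite dim_limg_lker0 ?symplectic_lker.
by move=> _ _ /memv_imgP[u uL ->] /memv_imgP[v vL ->]; rewrite sT wL.
Qed.

Lemma lagrangian_complement_limg T L W : symplectic_map T ->
  lagrangian_complement w L W -> lagrangian_complement w (T @: L) (T @: W).
Proof.
move=> sT [lW LW0 LWT]; have T0 := symplectic_lker sT; split.
- exact: lagrangian_limg.
- by rewrite -lker0_img_cap // LW0 limg0.
- by rewrite -limgD LWT lker0_limgf.
Qed.

(** The map [al x0] has its graph over [F x0] inside [F x0] itself, and its
    values in a complement. *)
Lemma chart_at_base (X : topologicalType) (A : set X) F (x0 : X) W al :
  A x0 -> chart_at w A F x0 W al -> forall v, v \in F x0 -> al x0 v = 0.
Proof.
move=> Ax0 [[_ FW0 _] /nbhs_singleton/(_ Ax0)[alW FE]] v vF.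
apply/eqP; rewrite -memv0 -FW0 memv_cap; apply/andP; split; last first.
  by apply: (subvP alW); exact: memv_img.
have : (\1 + al x0)%VF v \in F x0 by rewrite FE memv_img.
by rewrite add_lfunE id_lfunE => vaF; have := rpredB vaF vF; rewrite addrC addKr.
Qed.

Section Transport.
Variables (X : topologicalType) (A : set X) (x0 : X) (reg : (X -> R) -> Prop).
Hypothesis Ax0 : A x0.
Hypothesis regP : regular_class (within A (nbhs x0)) x0 reg.
Variables (F : X -> {vspace E}) (K : X -> 'End(E)).
Hypothesis Kreg : hreg reg K.
Hypothesis Ksympl : forall x, A x -> symplectic_map (K x).

(** Regularity of a curve or homotopy of Lagrangians survives the application
    of a regular family [K] of symplectic maps. In the splitting [L + W] of the
    space at [x0], the map [K x0^-1 K x (1 + al x)] has an [L]-component [P x]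
    and a [W]-component [Q x] on [L]; since [P x0] is the identity, [P x] is
    invertible nearby and the image is the graph of [Q x (P x)^-1], which is
    then moved by [K x0]. *)
Lemma chart_transport W al :
  chart_at w A F x0 W al ->
  (forall v, v \in F x0 -> vreg reg (fun x => al x v)) ->
  exists W' al', chart_at w A (fun x => K x @: F x)%VS x0 W' al' /\
    forall v, v \in (K x0 @: F x0)%VS -> vreg reg (fun x => al' x v).
Proof.
move=> alF alr; have al0 := chart_at_base Ax0 alF.
have [cW alE] := alF; have [lW LW0 LWT] := cW.
have WL0 : (W :&: F x0)%VS = 0%VS by rewrite capvC.
have K0 := symplectic_lker (Ksympl Ax0).
set L := F x0 in alr al0 alE LW0 LWT WL0 cW *.
set J := ((K x0)^-1)%VF.
pose pL := daddv_pi L W; pose pW := daddv_pi W L.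
have pLm v : pL v \in L by exact: memv_pi.
have pWm v : pW v \in W by exact: memv_pi.
have pLW v : pL v + pW v = v by apply: daddv_pi_add; rewrite ?LWT ?memvf.
have pLL v : v \in L -> pL v = v by exact: daddv_pi_id.
have pWL v : v \in L -> pW v = 0.
  by move=> vL; apply: (addrI (pL v)); rewrite pLW addr0 pLL.
pose M x := (J \o (K x \o ((\1 + al x) \o pL)))%VF.
(* [P x] is extended by the identity on [W], so as to be inverted as an
   endomorphism of the whole space. *)
pose P x := (pL \o M x + pW)%VF.
have alr' : hreg reg (fun x => (al x \o pL)%VF).
  move=> v; under [X in vreg _ X]funext do rewrite comp_lfunE.
  by apply: alr; exact: memv_pi.
have Mr : hreg reg M.
  have cst (S : 'End(E)) : hreg reg (fun=> S) by exact: (hreg_cst regP).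
  apply: (hregM regP) => //; apply: (hregM regP) => //.
  under [X in hreg _ X]funext do rewrite comp_lfunDl.
  by apply: (hregD regP) => //; exact: cst.
have Pr : hreg reg P.
  by apply: (hregD regP); [apply: (hregM regP) => // | ]; exact: (hreg_cst regP).
have P0 : P x0 = \1%VF.
  apply/lfunP => v; rewrite add_lfunE !comp_lfunE [(\1 + _)%VF _]add_lfunE.
  rewrite al0 // addr0 lker0_lfunK // !id_lfunE.
  by rewrite pLL.
have [S Sr SP] := hreg_inv regP Pr P0.
pose Q x := (pW \o M x)%VF.
exists (K x0 @: W)%VS, (fun x => K x0 \o (Q x \o (S x \o J)))%VF; split.
  split; first exact: lagrangian_complement_limg (Ksympl Ax0) cW.
  have nA : \forall x \near within A (nbhs x0), A x by exact: withinT.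
  apply: filterS (filterI nA (filterI alE SP)) => x [Ax [[alW FE] SPx]].
  split.
    apply/subvP => _ /memv_imgP[v _ ->].
    by rewrite comp_lfunE; apply: memv_img; rewrite comp_lfunE [Q x _]comp_lfunE.
  have PLL : (P x @: L)%VS = L.
    have P0' : lker (P x) == 0%VS.
      by apply/lker0P; apply: (can_inj (g := S x)) => v;
        rewrite -comp_lfunE SPx id_lfunE.
    apply/eqP; rewrite eqEdim dim_limg_lker0 // leqnn andbT.
    apply/subvP => _ /memv_imgP[v vL ->].
    by rewrite add_lfunE pWL // addr0 comp_lfunE.
  rewrite FE -/L -{2}PLL -!limg_comp; apply: eq_in_limg => u uL.
  have PE : P x u = pL (M x u).
    by rewrite add_lfunE pWL // addr0 comp_lfunE.
  have SPu : S x (P x u) = u by rewrite -[LHS]comp_lfunE SPx id_lfunE.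
  have QE : Q x u = pW (M x u) by rewrite comp_lfunE.
  have ME : K x0 (M x u) = K x ((\1 + al x)%VF u).
    by rewrite !comp_lfunE (pLL _ uL) -[LHS]comp_lfunE lker0_compfV // id_lfunE.
  rewrite comp_lfunE -ME -[in LHS](pLW (M x u)) -PE -QE linearD.
  rewrite 2![RHS]comp_lfunE [RHS]add_lfunE [X in _ = X + _]id_lfunE [X in _ = _ + X]comp_lfunE.
  have JK v : J (K x0 v) = v by exact: lker0_lfunK.
  have -> : (Q x \o (S x \o J))%VF (K x0 (P x u)) = Q x u.
    by rewrite comp_lfunE -{2}SPu -{2}[P x u]JK; congr (Q x _); exact: comp_lfunE.
  by [].
move=> v _; move: v; change (hreg reg (fun x => (K x0 \o (Q x \o (S x \o J)))%VF)).
have cst (T : 'End(E)) : hreg reg (fun=> T) by exact: (hreg_cst regP).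
apply: (hregM regP) => //; apply: (hregM regP); last exact: (hregM regP).
exact: (hregM regP).
Qed.

End Transport.
End SymplecticMaps.

(** * The derivative of a moved Lagrangian curve *)

Section CrossingForm.
Variable R : realType.

(** At an endpoint of the interval only a one-sided limit of the difference
    quotients is known, but it already determines the derivative. *)
Lemma derive1_near_itv_eq0 (a b t0 : R) (f : R -> R) :
  a < b -> t0 \in `[a, b] -> derivable f t0 1 ->
  (\forall t \near within `[a, b] (nbhs t0), f t = 0) -> derive1 f t0 = 0.
Proof.
move=> ab t0ab df f0; rewrite derive1E.
have ft0 : f t0 = 0 by move/nbhs_singleton: f0; apply.
have lim0 (D : set_system R) : ProperFilter D -> D `=>` 0^' ->
    (\forall h \near D, h + t0 \in `[a, b]) -> 'D_1 f t0 = 0.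
  move=> PD D0 Dab; pose q h := h^-1 *: (f (h *: 1 + t0) - f t0).
  have q1 : q h @[h --> D] --> 'D_1 f t0.
    by apply: cvg_trans (cvg_app q D0) _; exact: df.
  have q2 : q h @[h --> D] --> (0 : R).
    apply: cvg_near_cst.
    have ht0 : h + t0 @[h --> D] --> t0.
      rewrite -[X in _ --> X]add0r; apply: cvgD; last exact: cvg_cst.
      apply: (cvg_trans (cvg_app idfun D0)) => P P0; exact: (@cvg_within _ (nbhs 0) _ _ P P0).
    have nf0 : \forall h \near D, h + t0 \in `[a, b] -> f (h + t0) = 0 := ht0 _ f0.
    near=> h; have fh : f (h + t0) = 0 by near: h; apply: filterS2 Dab nf0 => h hab; exact.
    by rewrite /q /GRing.scale /= mulr1 fh // ft0 subrr mulr0.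
  exact: (cvg_unique _ q1 q2).
have /andP[at0 t0b] : a <= t0 <= b by move: t0ab; rewrite in_itv.
have [t0b'|bt0] := ltP t0 b.
  apply: (lim0 0^'+); first by apply: within_subset => h /= h0; rewrite gt_eqF.
  near=> h; have h0 : 0 < h by near: h; exact: nbhs_right_gt.
  have hb : h < b - t0 by near: h; apply: nbhs_right_lt; rewrite subr_gt0.
  by rewrite in_itv/= -lerBrDr (ltW hb) andbT (le_trans at0)// lerDr ltW.
apply: (lim0 0^'-); first by apply: within_subset => h /= h0; rewrite lt_eqF.
near=> h; have h0 : h < 0 by near: h; exact: nbhs_left_lt.
have hb : a - t0 < h.
  by near: h; apply: nbhs_left_gt; rewrite subr_lt0 (lt_le_trans ab).
by rewrite in_itv/= -lerBlDr (ltW hb)/= (le_trans _ t0b)// gerDr ltW.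
Unshelve. all: by end_near. Qed.

Lemma derivable_smooth_near (f : R -> R) (t0 : R) :
  smooth_near f t0 -> derivable f t0 1.
Proof. by move=> /nbhs_singleton/(_ 0%N). Qed.

Variables (E : vectType R) (w : symplectic_form E).

Let smooth_at (t0 : R) := fun f : R -> R => smooth_near f t0.

(** The product rule at a zero of the factor [u]: the variation of [G] with [t]
    does not contribute. *)
Lemma is_derive_vanishing (t0 : R) (G : R -> E -> R) (u : R -> E) :
  (forall t, linear (G t : E -> R^o)) ->
  (forall x, smooth_near (G^~ x) t0) ->
  vreg (smooth_at t0) u -> u t0 = 0 ->
  is_derive t0 1 (fun t => G t (u t)) (derive1 (fun t => G t0 (u t)) t0).
Proof.
move=> Gl Gs us u0.
have coord t s : G t (u s) =
    \sum_i v2r (u s) 0 i * G t (r2v (delta_mx 0 i)).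
  rewrite -[LHS](linfun_linear (Gl t)) {1}(v2r_delta (u s)) linear_sum.
  by apply: eq_bigr => i _; rewrite linearZ /= (linfun_linear (Gl t)).
pose c i (t : R) : R := v2r (u t) 0 i.
have cs i : derivable (c i) t0 1.
  apply: derivable_smooth_near.
  by have /(vreg_coord (regular_smooth setT t0))/(_ 0 i) := us.
have c0 i : c i t0 = 0 by rewrite /c u0 linear0 mxE.
have term (H : R -> R) i : derivable H t0 1 ->
    is_derive t0 1 (fun t => c i t * H t) (derive1 (c i) t0 * H t0).
  move=> dH; rewrite derive1E.
  have := is_deriveM (derivableP (cs i)) (derivableP dH).
  by rewrite c0 scale0r add0r => d; apply: is_derive_eq; rewrite mulrC.
have sumd (H : 'I_(dim E) -> R -> R) : (forall i, derivable (H i) t0 1) ->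
    is_derive t0 1 (fun t => \sum_i c i t * H i t)
      (\sum_i derive1 (c i) t0 * H i t0).
  move=> dH; rewrite (_ : (fun t => _) = \sum_i (fun t => c i t * H i t)).
    by apply: is_derive_sum => i; exact: term.
  by apply/funext => t; rewrite fct_sumE.
have -> : derive1 (fun t => G t0 (u t)) t0 =
    \sum_i derive1 (c i) t0 * G t0 (r2v (delta_mx 0 i)).
  have := sumd (fun i _ => G t0 (r2v (delta_mx 0 i))) (fun i => derivable_cst _ _ _).
  by move=> /(@derive_val _ _ _ _ _ _ _) <-; rewrite derive1E; congr ('D_1 _ t0);
    apply/funext => t; rewrite coord.
under [X in is_derive _ _ X _]funext do rewrite coord.
by apply: sumd => i; exact: derivable_smooth_near.
Qed.

Lemma vreg_sform (X : Type) (F : set_system X) (x0 : X) reg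
    (regP : regular_class F x0 reg) (u : X -> E) v :
  vreg reg u -> reg (fun x => w v (u x)) /\ reg (fun x => w (u x) v).
Proof.
move=> ur; have lw : linear (w v : E -> R^o) := sform_linear w v.
have rl : reg (fun x => w v (u x)) := vreg_linear lw ur.
split=> //; under [X in reg X]funext do rewrite sformC -mulN1r.
by apply: (regM regP) => //; exact: (reg_cst regP).
Qed.

(** Both [v + al t v], moved by [K t], and [K t0 v' + al' t (K t0 v')] lie in
    the Lagrangian [La' t], so [w] vanishes on them. Expanding this into four
    terms and differentiating at [t0], where [al] and [al'] vanish, the term
    without [al] and [al'] disappears by hypothesis, the one containing both is
    of second order, and the two others give the equation. For [K] the identity
    this shows at once that the form is symmetric and independent of the
    chart. *)
Lemma derive_moved_crossing_form (a b t0 : R) (La La' : R -> {vspace E})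
    (K : R -> 'End(E)) W W' al al' (v v' : E) :
  a < b -> t0 \in `[a, b] ->
  (forall t, t \in `[a, b] -> symplectic_map w (K t)) ->
  hreg (smooth_at t0) K ->
  (forall t, t \in `[a, b] -> La' t = (K t @: La t)%VS) ->
  (forall t, t \in `[a, b] -> lagrangian w (La' t)) ->
  smooth_chart_at w a b La t0 W al -> smooth_chart_at w a b La' t0 W' al' ->
  v \in La t0 -> v' \in La t0 ->
  (forall t, t \in `[a, b] -> w (K t v) (K t0 v') = 0) ->
  derive1 (fun t => w (K t0 v) (al' t (K t0 v'))) t0 =
  derive1 (fun t => w v' (al t v)) t0.
Proof.
move=> ab t0ab Ks Kr LaE lLa' [ch als] [ch' als'] vL vL' wK0.
have regP := regular_smooth `[a, b] t0.
have At0 : `[a, b]%classic t0 by [].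
have al0 := chart_at_base At0 ch vL.
have vL2 : K t0 v' \in La' t0 by rewrite LaE // memv_img.
have al0' := chart_at_base At0 ch' vL2.
have dal : vreg (smooth_at t0) (fun t => al t v) by move=> f; exact: als.
have dal' : vreg (smooth_at t0) (fun t => al' t (K t0 v')) by move=> f; exact: als'.
have wl x : linear (w x : E -> R^o) by exact: sform_linear.
have d2 : is_derive t0 1 (fun t => w (K t (al t v)) (K t0 v'))
    (- derive1 (fun t => w v' (al t v)) t0).
  rewrite -[X in is_derive _ _ _ X]mulN1r.
  have -> : -1 * derive1 (fun t => w v' (al t v)) t0 =
      derive1 (fun t => w (K t0 (al t v)) (K t0 v')) t0.
    have dw : is_derive t0 1 (fun t => w v' (al t v))
        (derive1 (fun t => w v' (al t v)) t0).
      rewrite derive1E; apply/derivableP/derivable_smooth_near.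
      by have [] := vreg_sform regP v' dal.
    rewrite [RHS]derive1E.
    have -> : (fun t => w (K t0 (al t v)) (K t0 v')) = - (fun t => w v' (al t v)).
      by apply/funext => t; rewrite Ks // sformC.
    by rewrite (derive_val (is_derive := is_deriveN dw)) mulN1r.
  apply: (@is_derive_vanishing t0 (fun t x => w (K t x) (K t0 v'))) => // [t c x y|x].
    by rewrite linearP sformC sformP opprD -mulrN -!sformC.
  by have [] := vreg_sform regP (K t0 v') (Kr x).
have d3 : is_derive t0 1 (fun t => w (K t v) (al' t (K t0 v')))
    (derive1 (fun t => w (K t0 v) (al' t (K t0 v'))) t0).
  apply: (@is_derive_vanishing t0 (fun t x => w (K t v) x)) => // x.
  by have [] := vreg_sform regP x (Kr v).
have d4 : is_derive t0 1 (fun t => w (K t (al t v)) (al' t (K t0 v'))) 0.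
  have := @is_derive_vanishing t0 (fun t x => w (K t (al t v)) x) _
    (fun t => wl _) _ dal' al0'.
  rewrite al0 linear0.
  have -> : (fun t => w 0 (al' t (K t0 v'))) = cst 0.
    by apply/funext => t; rewrite sform0l.
  rewrite derive1_cst; apply => x.
  by have [] := vreg_sform regP x (vreg_app regP Kr dal).
have := is_deriveD (is_deriveD d2 d3) d4; rewrite addr0 => dsum.
have := @derive1_near_itv_eq0 a b t0 _ ab t0ab (ex_derive (is_derive := dsum)).
rewrite derive1E (derive_val (is_derive := dsum)) => sum0.
apply/eqP; rewrite -subr_eq0 addrC; apply/eqP/sum0.
have nA : \forall t \near within `[a, b] (nbhs t0), `[a, b]%classic t by exact: withinT.
apply: filterS (filterI nA (filterI ch.2 ch'.2)) => t [tab [[_ LtE] [_ Lt'E]]].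
have [_ isoL] := lLa' t tab.
have vLt : K t v + K t (al t v) \in La' t.
  rewrite LaE // -linearD memv_img // LtE.
  by rewrite (_ : v + al t v = (\1 + al t)%VF v) ?memv_img // add_lfunE id_lfunE.
have vLt' : K t0 v' + al' t (K t0 v') \in La' t.
  rewrite Lt'E (_ : _ + _ = (\1 + al' t)%VF (K t0 v')) ?memv_img //.
  by rewrite add_lfunE id_lfunE.
have := isoL _ _ vLt vLt'; rewrite !sformDr !sformDl wK0 // add0r => <-.
by rewrite -addrA.
Qed.

End CrossingForm.

(** * Invariance of the signature *)

Section Signature.
Variables (R : realType) (E : vectType R).
Implicit Types (U : {vspace E}) (q : E -> E -> R).

Definition symmetric_form_on U q :=
  {in U &, forall u v, q u v = q v u} /\
  (forall u v x a, u \in U -> v \in U -> x \in U ->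
     q u (a *: v + x) = a * q u v + q u x).

Lemma form_sumr U q (I : Type) (r : seq I) (c : I -> R) (e : I -> E) u :
  symmetric_form_on U q -> u \in U -> (forall i, e i \in U) ->
  q u (\sum_(i <- r) c i *: e i) = \sum_(i <- r) c i * q u (e i).
Proof.
move=> [_ ql] uU eU; elim: r => [|i r IH].
  have := ql u 0 0 1 uU (mem0v _) (mem0v _); rewrite !big_nil scaler0 addr0 mul1r.
  by move=> /eqP; rewrite -subr_eq0 opprD addNKr oppr_eq0 => /eqP.
rewrite !big_cons ql ?IH // rpred_sum // => j _; exact: rpredZ.
Qed.

(** The form [q'] is the pullback of [q] by [T]: its Gram matrix is
    [Q G Q^T], where [G] is that of [q] and [Q] expresses [T] in the two bases. *)
Lemma nb_eigenvalues_gram_le U U' q q' (T : 'End(E)) :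
  symmetric_form_on U q -> {in U', forall u, T u \in U} ->
  {in U' &, forall u v, q' u v = q (T u) (T v)} ->
  (nb_eigenvalues (gram U' q') [set x | (0 < x)%R] <=
     nb_eigenvalues (gram U q) [set x | (0 < x)%R])%N /\
  (nb_eigenvalues (gram U' q') [set x | (x < 0)%R] <=
     nb_eigenvalues (gram U q) [set x | (x < 0)%R])%N.
Proof.
move=> qU TU q'E; have [qs _] := qU.
pose b k := tnth (vbasis U) k; pose b' k := tnth (vbasis U') k.
have bU k : b k \in U by apply: vbasis_mem; exact: mem_tnth.
have bU' k : b' k \in U' by apply: vbasis_mem; exact: mem_tnth.
pose Q := \matrix_(i < \dim U', k < \dim U) coord (vbasis U) k (T (b' i)).
have TE i : T (b' i) = \sum_k Q i k *: b k.
  rewrite {1}(coord_vbasis (TU _ (bU' i))); apply: eq_bigr => k _.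
  by rewrite mxE -tnth_nth.
apply: (real_inertia_le (Q := Q)).
  by apply/matrixP => i j; rewrite !mxE qs.
apply/matrixP => i j; rewrite !mxE q'E // !TE.
have TUi : \sum_k Q i k *: b k \in U by rewrite -TE TU.
rewrite (form_sumr _ _ qU) //; apply: eq_bigr => k _.
rewrite qs // (form_sumr _ _ qU) // [RHS]mulrC !mxE; congr (_ * _).
by apply: eq_bigr => l _; rewrite !mxE qs.
Qed.

Lemma Sign_transport U U' q q' (T : 'End(E)) :
  lker T == 0%VS -> U' = (T @: U)%VS ->
  symmetric_form_on U q ->
  {in U &, forall u v, q' (T u) (T v) = q u v} ->
  Sign U' q' = Sign U q.
Proof.
move=> T0 -> qU q'E.
have TK := lker0_lfunK T0.
have TU u : u \in (T @: U)%VS -> (T^-1)%VF u \in U.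
  by move=> /memv_imgP[v vU ->]; rewrite TK.
have q'U : symmetric_form_on (T @: U)%VS q'.
  case: qU => qs ql; split.
    by move=> _ _ /memv_imgP[u uU ->] /memv_imgP[v vU ->]; rewrite !q'E // qs.
  move=> _ _ _ c /memv_imgP[u uU ->] /memv_imgP[v vU ->] /memv_imgP[x xU ->].
  by rewrite -linearP !q'E ?ql // rpredD // rpredZ.
have [p1 n1] : _ /\ _ := nb_eigenvalues_gram_le (T := T) q'U
  (fun u uU => memv_img T uU) (fun u v uU vU => esym (q'E u v uU vU)).
have [||p2 n2] := @nb_eigenvalues_gram_le U (T @: U)%VS q q' (T^-1)%VF qU.
- by move=> u; exact: TU.
- by move=> _ _ /memv_imgP[u uU ->] /memv_imgP[v vU ->]; rewrite !TK q'E.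
by rewrite /Sign; congr (_%:Z - _%:Z); apply/eqP; rewrite eqn_leq ?p1 ?p2 ?n1 ?n2.
Qed.

End Signature.

(** * Transport of the index by a symplectic path preserving the reference *)

Section Transport.
Variables (R : realType) (E : vectType R) (w : symplectic_form E).
Variables (a b : R).
Hypothesis ab : a < b.

Definition smooth_symplectic_path (K : R -> 'End(E)) :=
  forall t, t \in `[a, b] ->
    symplectic_map w (K t) /\ hreg (fun f => smooth_near f t) K.

Lemma QformP (La : R -> {vspace E}) t0 : lagr_smooth w a b La -> t0 \in `[a, b] ->
  exists W al, smooth_chart_at w a b La t0 W al /\
    Qform w a b La t0 = fun v v' => derive1 (fun t => w v (al t v')) t0.
Proof.
move=> Las t0ab; have [_ [W [al ch]]] := Las t0 t0ab.
rewrite /Qform; case: xgetP => [q _ [W' [al' [ch' ->]]]|]; first by exists W', al'.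
by move/(_ (fun v v' => derive1 (fun t => w v (al t v')) t0)) => []; exists W, al.
Qed.

Lemma lagr_smooth_transport La K : smooth_symplectic_path K ->
  lagr_smooth w a b La -> lagr_smooth w a b (fun t => K t @: La t)%VS.
Proof.
move=> Ks Las t0 t0ab; have [lLa [W [al [ch als]]]] := Las t0 t0ab.
have [Ks0 Kr] := Ks t0 t0ab; split; first exact: lagrangian_limg.
have [W' [al' [ch' als']]] := chart_transport (A := `[a, b]%classic) t0ab (regular_smooth _ t0) Kr
  (fun t tab => (Ks t tab).1) ch (fun v vL f => als v f vL).
by exists W', al'; split => // v f vL; exact: als'.
Qed.

(** The arguments are exchanged on the right-hand side because the comparison
    of charts yields the transposed form; this makes the symmetry of the form a
    special case. *)
Lemma Qform_transport La K t0 v v' : smooth_symplectic_path K ->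
  lagr_smooth w a b La -> t0 \in `[a, b] -> v \in La t0 -> v' \in La t0 ->
  (forall t, t \in `[a, b] -> w (K t v) (K t0 v') = 0) ->
  Qform w a b (fun t => K t @: La t)%VS t0 (K t0 v) (K t0 v') =
  Qform w a b La t0 v' v.
Proof.
move=> Ks Las t0ab vL v'L wK; have KLas := lagr_smooth_transport Ks Las.
have [W [al [ch ->]]] := QformP Las t0ab.
have [W' [al' [ch' ->]]] := QformP KLas t0ab.
apply: (derive_moved_crossing_form ab t0ab _ (Ks t0 t0ab).2 _ _ ch ch') => //.
- by move=> t /Ks[].
- by move=> t /KLas[].
Qed.

Lemma Qform_symmetric La t0 : lagr_smooth w a b La -> t0 \in `[a, b] ->
  symmetric_form_on (La t0) (Qform w a b La t0).
Proof.
move=> Las t0ab; split => [v v' vL v'L|v u x c vL uL xL].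
  (* Transport by the constant identity path exchanges the arguments. *)
  have id_path : smooth_symplectic_path (fun=> \1%VF).
    move=> t _; split=> [u x|]; first by rewrite !id_lfunE.
    exact: (hreg_cst (regular_smooth `[a, b] t)).
  have := @Qform_transport La _ t0 v v' id_path Las t0ab vL v'L.
  rewrite !id_lfunE; under [X in Qform _ _ _ X]funext do rewrite lim1g.
  apply => t _; have [[_ isoL] _] := Las t0 t0ab.
  by rewrite ?id_lfunE; apply: isoL.
have [W [al [[_ als] ->]]] := QformP Las t0ab.
have dal y : y \in La t0 -> derivable (fun t => w v (al t y)) t0 1.
  move=> yL; apply: derivable_smooth_near.
  have alr : vreg (fun f => smooth_near f t0) (fun t => al t y).
    by move=> f; exact: als.
  by have [] := vreg_sform w (regular_smooth setT t0) v alr.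
rewrite !derive1E.
have -> : (fun t => w v (al t (c *: u + x))) =
    c *: (fun t => w v (al t u)) + (fun t => w v (al t x)).
  by apply/funext => t; rewrite linearP sformP.
rewrite deriveD; [|exact: derivableZ (dal _ uL) |exact: dal].
by rewrite deriveZ //; exact: dal.
Qed.

Section CrossingForms.
Variables (V : {vspace E}) (La : R -> {vspace E}) (K : R -> 'End(E)).
Hypothesis lV : lagrangian w V.
Hypothesis Ks : smooth_symplectic_path K.
Hypothesis KV : forall t, t \in `[a, b] -> (K t @: V)%VS = V.
Hypothesis Las : lagr_smooth w a b La.

Let KLa t := (K t @: La t)%VS.

Lemma lker_path t : t \in `[a, b] -> lker (K t) == 0%VS.
Proof. by move=> /Ks[/symplectic_lker]. Qed.

Lemma cap_transport t : t \in `[a, b] ->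
  (KLa t :&: V)%VS = (K t @: (La t :&: V))%VS.
Proof. by move=> tab; rewrite lker0_img_cap ?lker_path // KV. Qed.

(** The moving map contributes [w (K t v) (K t0 v')], which vanishes as both
    vectors lie in the Lagrangian [V] preserved by [K]. *)
Lemma crossing_form_transport t : t \in `[a, b] ->
  {in (La t :&: V)%VS &, forall v v',
    Qform w a b KLa t (K t v) (K t v') = Qform w a b La t v v'}.
Proof.
move=> tab v v'; rewrite !memv_cap => /andP[vL vV] /andP[v'L v'V].
rewrite /KLa Qform_transport //; last first.
  move=> s sab; have [_ isoV] := lV.
  by apply: isoV; [rewrite -(KV sab) | rewrite -(KV tab)]; exact: memv_img.
by have [] := Qform_symmetric Las tab => ->.
Qed.

Lemma symmetric_crossing_form t : t \in `[a, b] ->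
  symmetric_form_on (La t :&: V)%VS (Qform w a b La t).
Proof.
move=> tab; have [qs ql] := Qform_symmetric Las tab; split.
  by move=> u v; rewrite !memv_cap => /andP[uL _] /andP[vL _]; exact: qs.
move=> u v x c; rewrite !memv_cap => /andP[uL _] /andP[vL _] /andP[xL _].
exact: ql.
Qed.

Lemma crossing_transport t : t \in `[a, b] ->
  crossing KLa V t <-> crossing La V t.
Proof.
move=> tab; rewrite /crossing cap_transport // -{1}(limg0 (K t)).
by rewrite (eq_limg_ker0 _ _ (lker_path tab)).
Qed.

Lemma regular_crossings_transport :
  regular_crossings w a b La V -> regular_crossings w a b KLa V.
Proof.
move=> reg t tab /(crossing_transport tab) cr v.
rewrite cap_transport // => /memv_imgP[u uU ->] q0.
rewrite (reg t tab cr u) ?linear0 // => u' u'U.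
by rewrite -crossing_form_transport // q0 // memv_img.
Qed.

Lemma Sign_crossing_transport t : t \in `[a, b] ->
  Sign (KLa t :&: V) (Qform w a b KLa t) = Sign (La t :&: V) (Qform w a b La t).
Proof.
move=> tab; apply: (Sign_transport (lker_path tab) (cap_transport tab)).
  exact: symmetric_crossing_form.
exact: crossing_form_transport.
Qed.

Lemma RS_regular_transport : RS_regular w a b KLa V = RS_regular w a b La V.
Proof.
have [aab bab] : a \in `[a, b] /\ b \in `[a, b].
  by rewrite !in_itv/= !lexx (ltW ab).
rewrite /RS_regular !Sign_crossing_transport //.
congr (_ + _ + _).
have itv t : a < t < b -> t \in `[a, b].
  by move=> /andP[at_ tb]; rewrite in_itv/= !ltW.
have -> : [set t | a < t < b /\ crossing KLa V t] =
    [set t | a < t < b /\ crossing La V t].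
  by apply/seteqP; split=> t /= [tab cr]; split=> //;
    apply/(crossing_transport (itv t tab)).
apply: eq_fsbigr => t /set_mem [tab _].
by rewrite Sign_crossing_transport // itv.
Qed.

End CrossingForms.

Definition RS_values (La : R -> {vspace E}) (V : {vspace E}) : set R :=
  [set mu | exists La', [/\ lagr_smooth w a b La',
    regular_crossings w a b La' V, lagr_homotopic w a b La La' &
    mu = RS_regular w a b La' V]].

Lemma muRS_lagrE La V : muRS_lagr w a b La V = xget 0 (RS_values La V).
Proof. by []. Qed.

Lemma lagr_continuous_transport (X : topologicalType) (A : set X)
    (F : X -> {vspace E}) (K : X -> 'End(E)) :
  (forall x, A x -> symplectic_map w (K x)) ->
  (forall x0, A x0 ->
     hreg (fun f : X -> R => f x @[x --> within A (nbhs x0)] --> f x0) K) ->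
  lagr_continuous w A F -> lagr_continuous w A (fun x => K x @: F x)%VS.
Proof.
move=> Ks Kr Fc x0 Ax0; have [lF [W [al [ch alc]]]] := Fc x0 Ax0.
split; first by apply: lagrangian_limg => //; exact: Ks.
have [W' [al' [ch' alc']]] := chart_transport Ax0 (regular_continuous R Ax0)
  (Kr x0 Ax0) Ks ch (fun v vL f => alc v f vL).
by exists W', al'; split => // v f vL; exact: alc'.
Qed.

(** A representative [La'] of [La] is moved by the smooth end [h (1, t)] of the
    homotopy, while the homotopy from [La] to [La'] is moved by [h] itself; this
    gives in one step a homotopy with fixed ends from [h (0, t) La t]. *)
Lemma RS_values_transport (V : {vspace E}) (h : R * R -> 'End(E))
    (La : R -> {vspace E}) (A := `[(0 : R), 1] `*` `[a, b]) :
  lagrangian w V ->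
  (forall x, A x -> symplectic_map w (h x) /\ (h x @: V)%VS = V) ->
  (forall x0, A x0 ->
     hreg (fun f : R * R -> R => f x @[x --> within A (nbhs x0)] --> f x0) h) ->
  (forall t, t \in `[a, b] ->
     hreg (fun f => smooth_near f t) (fun t => h (1, t))) ->
  (forall s, s \in `[0, 1] -> h (s, a) = h (0, a) /\ h (s, b) = h (0, b)) ->
  RS_values La V `<=` RS_values (fun t => h (0, t) @: La t)%VS V.
Proof.
move=> lV hA hc h1s hends _ [La' [Las Lar [H [Hc H0 H1 Ha Hb]] ->]].
have h1A t : t \in `[a, b] -> A (1, t).
  by move=> tab; split => //=; rewrite in_itv/= ler01 lexx.
have Ks : smooth_symplectic_path (fun t => h (1, t)).
  by move=> t tab; split; [have [] := hA _ (h1A t tab) | exact: h1s].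
have KV t : t \in `[a, b] -> (h (1, t) @: V)%VS = V.
  by move=> tab; have [] := hA _ (h1A t tab).
exists (fun t => h (1, t) @: La' t)%VS; split.
- exact: lagr_smooth_transport.
- exact: regular_crossings_transport.
- exists (fun x => h x @: H x)%VS; split.
  + by apply: lagr_continuous_transport => // x /hA[].
  + by move=> t tab; rewrite H0.
  + by move=> t tab; rewrite H1.
  + by move=> s s01; rewrite Ha // (hends s s01).1.
  + by move=> s s01; rewrite Hb // (hends s s01).2.
- by rewrite RS_regular_transport.
Qed.

Lemma eq_RS_values La1 La2 V : (forall t, t \in `[a, b] -> La1 t = La2 t) ->
  RS_values La1 V `<=` RS_values La2 V.
Proof.
have [aab bab] : a \in `[a, b] /\ b \in `[a, b].
  by rewrite !in_itv/= !lexx (ltW ab).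
move=> eL mu [La' [? ? [H [Hc H0 H1 Ha Hb]] ->]]; exists La'; split=> //.
by exists H; split=> // t tI; rewrite -eL ?H0 ?Ha ?Hb.
Qed.

End Transport.

(** * The diagonal action of the symplectic group on graphs *)

Section SymplecticGroup.
Variables (R : realType) (n : nat).
Implicit Types A B : 'M[R]_(n + n).

Lemma det_Omega0 : \det (@Omega0 R n) != 0.
Proof.
have : (@Omega0 R n) *m (- @Omega0 R n) = 1%:M.
  rewrite /Omega0 opp_block_mx mulmx_block !oppr0 !opprK !mulmx0 !mul0mx.
  by rewrite !mul1mx !mulNmx !mulmxN !mul1mx !opprK !add0r !addr0 -scalar_mx_block.
move=> /mulmx1_unit[]; rewrite unitmxE unitfE => //.
Qed.

Lemma Sp_unitmx A : Sp A -> A \in unitmx.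
Proof.
move=> /(congr1 determinant); rewrite !det_mulmx det_tr => dA.
rewrite unitmxE unitfE; apply: contra_eq_neq dA => ->.
by rewrite mulr0 eq_sym det_Omega0.
Qed.

Lemma SpM A B : Sp A -> Sp B -> Sp (A *m B).
Proof.
move=> sA sB; rewrite /Sp /= trmx_mul -[RHS]sB -[in RHS]sA.
by rewrite !mulmxA.
Qed.

Lemma SpV A : Sp A -> Sp (invmx A).
Proof.
move=> sA; have uA := Sp_unitmx sA; rewrite /Sp /= -{1}sA !mulmxA.
by rewrite -trmx_mul mulmxV // trmx1 mul1mx -mulmxA mulmxV // mulmx1.
Qed.

Local Notation E := ('cV[R]_(n + n) * 'cV[R]_(n + n))%type.

Definition diag_act A : 'End(E) := linfun (fun u : E => (A *m u.1, A *m u.2)).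

Lemma diag_actE A u : diag_act A u = (A *m u.1, A *m u.2).
Proof.
by apply: linfun_linear => c x y; congr pair; rewrite /= mulmxDr -scalemxAr.
Qed.

Lemma memv_Gr A (u : E) : (u \in Gr A) = (u.2 == A *m u.1).
Proof.
have GE x : linfun (fun x : 'cV[R]_(n + n) => (x, A *m x) : E) x = (x, A *m x).
  by apply: linfun_linear => c y z; congr pair; rewrite mulmxDr -scalemxAr.
apply/memv_imgP/eqP => [[x _ ->]|uE]; first by rewrite GE.
by exists u.1; rewrite ?memvf // GE -uE; case: u {uE}.
Qed.

Lemma Delta_Gr : @Delta R n = Gr 1%:M.
Proof.
by rewrite /Delta /Gr; congr (limg (linfun _)); apply/funext => x; rewrite mul1mx.
Qed.

(** A pair [(x, B x)] is sent to [(A x, A B x)], which is the point of the new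
    graph over [A x]. *)
Lemma diag_act_Gr A B : A \in unitmx ->
  (diag_act A @: Gr B)%VS = Gr (A *m B *m invmx A).
Proof.
move=> uA; apply/vspaceP => u; rewrite memv_Gr; apply/memv_imgP/eqP.
  move=> [x]; rewrite memv_Gr => /eqP xE ->.
  by rewrite diag_actE /= xE mulmxA -!mulmxA mulKmx.
move=> uE; exists (invmx A *m u.1, invmx A *m u.2).
  by rewrite memv_Gr /= uE -!mulmxA mulKmx.
by rewrite diag_actE /= !mulKVmx //; case: u {uE}.
Qed.

Lemma diag_act_Delta A : A \in unitmx -> (diag_act A @: @Delta R n)%VS = @Delta R n.
Proof. by move=> uA; rewrite Delta_Gr diag_act_Gr // mulmx1 mulmxV. Qed.

Lemma diag_act_symplectic A : Sp A -> symplectic_map (@Omegabar R n) (diag_act A).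
Proof.
move=> sA u v; rewrite !diag_actE /= /Omegabar_fun /=.
have O x y : Omega0_form (A *m x) (A *m y) = Omega0_form x y.
  by rewrite /Omega0_form trmx_mul -[in RHS]sA !mulmxA.
by rewrite !O.
Qed.

Lemma lagrangian_Delta : lagrangian (@Omegabar R n) (@Delta R n).
Proof.
split; last first.
  move=> u v; rewrite Delta_Gr !memv_Gr !mul1mx => /eqP uE /eqP vE.
  by rewrite /= /Omegabar_fun uE vE addNr.
have dE x : linfun (fun x : 'cV[R]_(n + n) => (x, x) : E) x = (x, x).
  by apply: linfun_linear.
have inj : lker (linfun (fun x : 'cV[R]_(n + n) => (x, x) : E)) == 0%VS.
  by apply/lker0P => x y; rewrite !dE => -[].
by rewrite /Delta limg_dim_eq ?(eqP inj) ?capv0 // !dimvf -addnn.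
Qed.

Lemma hreg_diag_act (X : Type) (F : set_system X) (x0 : X) reg
    (regP : regular_class F x0 reg) (A : X -> 'M[R]_(n + n)) :
  mreg reg A -> hreg reg (fun x => diag_act (A x)).
Proof.
move=> Ar v f; have gl : linear (fun M : 'M[R]_(n + n) => f (M *m v.1, M *m v.2)).
  by move=> c M N; rewrite -linearP; congr (f (_, _)); rewrite mulmxDl -scalemxAl.
pose g := linfun (fun M : 'M[R]_(n + n) => f (M *m v.1, M *m v.2)).
have gE x : f (diag_act (A x) v) =
    \sum_i \sum_j A x i j * g (delta_mx i j).
  rewrite diag_actE -(linfun_linear gl) -/g {1}[A x]matrix_sum_delta linear_sum.
  apply: eq_bigr => i _; rewrite linear_sum; apply: eq_bigr => j _.
  by rewrite linearZ.
under [X in reg X]funext do rewrite gE.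
apply: (reg_sum regP) => i; apply: (reg_sum regP) => j.
by apply: (regM regP); [exact: Ar | exact: (reg_cst regP)].
Qed.

End SymplecticGroup.

(** * The Cayley transform *)

Section Cayley.
Variables (R : realType) (n : nat).
Local Notation "''Mat'" := 'M[R]_(n + n).
Implicit Types (X g : 'Mat).

(** The Lie algebra of the symplectic group. *)
Definition hamiltonian X := X^T *m Omega0 n + Omega0 n *m X = 0.

Definition cayley X := (1%:M + X) *m cramer (1%:M - X).
Definition cayley_inv g := (g - 1%:M) *m cramer (g + 1%:M).

Lemma hamiltonianD X Y : hamiltonian X -> hamiltonian Y -> hamiltonian (X + Y).
Proof.
by rewrite /hamiltonian linearD mulmxDl mulmxDr addrACA => -> ->; rewrite addr0.
Qed.

Lemma hamiltonianZ a X : hamiltonian X -> hamiltonian (a *: X).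
Proof.
rewrite /hamiltonian linearZ -scalemxAl -scalemxAr -scalerDr => ->.
exact: scaler0.
Qed.

(** For Hamiltonian [X], both [1 + X] and [1 - X] pull [Omega0] back to
    [Omega0 + X^T Omega0 X], because the terms of first order in [X] cancel. *)
Lemma Sp_cayley X : hamiltonian X -> \det (1%:M - X) != 0 -> Sp (cayley X).
Proof.
move=> hX d0; rewrite /Sp /= /cayley cramerE //; set Y := invmx _.
have u : 1%:M - X \in unitmx by rewrite unitmxE unitfE.
have key : (1%:M + X)^T *m Omega0 n *m (1%:M + X) =
    (1%:M - X)^T *m Omega0 n *m (1%:M - X).
  move: hX; rewrite /hamiltonian => /eqP; rewrite addr_eq0 => /eqP hX.
  rewrite [(_ + _)^T]linearD [(_ - _)^T]linearB /= trmx1.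
  rewrite !(mulmxDl, mulmxDr, mul1mx, mulmx1, mulNmx, mulmxN, mulmxBl, mulmxBr) hX.
  move: (_ *m X) => b; move: (_ *m X) => c.
  by apply/matrixP => i j; rewrite !mxE; ring.
rewrite trmx_mul -!mulmxA (mulmxA Y^T) !mulmxA.
have -> : Y^T *m (1%:M + X)^T *m Omega0 n *m (1%:M + X) *m Y =
  Y^T *m ((1%:M + X)^T *m Omega0 n *m (1%:M + X)) *m Y by rewrite !mulmxA.
rewrite key !mulmxA -trmx_mul mulmxV // trmx1 mul1mx -mulmxA mulmxV //.
by rewrite mulmx1.
Qed.

Lemma hamiltonian_cayley_inv g :
  Sp g -> \det (g + 1%:M) != 0 -> hamiltonian (cayley_inv g).
Proof.
move=> sg d0; rewrite /hamiltonian /cayley_inv cramerE //; set Y := invmx _.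
have u : g + 1%:M \in unitmx by rewrite unitmxE unitfE.
have uT : (g + 1%:M)^T \in unitmx by rewrite unitmx_tr.
have key : (g - 1%:M)^T *m Omega0 n *m (g + 1%:M) +
    (g + 1%:M)^T *m Omega0 n *m (g - 1%:M) = 0.
  rewrite [(g + 1%:M)^T]linearD [(g - 1%:M)^T]linearB /= trmx1.
  rewrite !(mulmxDl, mulmxDr, mul1mx, mulmx1, mulNmx, mulmxN, mulmxBl, mulmxBr) sg.
  move: (_ *m Omega0 n) (_ *m g) => b c.
  by apply/matrixP => i j; rewrite !mxE; ring.
have YT : Y^T *m (g + 1%:M)^T = 1%:M by rewrite -trmx_mul mulmxV // trmx1.
have Yg : (g + 1%:M) *m Y = 1%:M by rewrite mulmxV.
rewrite trmx_mul.
have := congr1 (fun M => Y^T *m M *m Y) key.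
rewrite mulmx0 mul0mx mulmxDr mulmxDl !mulmxA YT mul1mx.
by rewrite -(mulmxA _ (g + 1%:M)) Yg mulmx1.
Qed.

Lemma cayley_invE g : \det (g + 1%:M) != 0 ->
  1%:M - cayley_inv g = 2 *: invmx (g + 1%:M) /\
  1%:M + cayley_inv g = 2 *: (g *m invmx (g + 1%:M)).
Proof.
move=> d0; rewrite /cayley_inv cramerE //.
have u : g + 1%:M \in unitmx by rewrite unitmxE unitfE.
set Y := invmx _; have YE : g *m Y + Y = 1%:M.
  by rewrite -[X in _ + X]mul1mx -mulmxDl mulmxV.
rewrite mulmxBl mul1mx -[X in X - _]YE -[X in X + (_ - _)]YE.
by split; apply/matrixP => i j; rewrite !mxE; ring.
Qed.

Lemma cayley_invK g : \det (g + 1%:M) != 0 -> cayley (cayley_inv g) = g.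
Proof.
move=> d0; have u : g + 1%:M \in unitmx by rewrite unitmxE unitfE.
have [m p] := cayley_invE d0; rewrite /cayley m p.
have inv2 : (2 *: invmx (g + 1%:M)) *m (2^-1 *: (g + 1%:M)) = 1%:M.
  by rewrite -scalemxAl -scalemxAr scalerA mulVmx // divff ?scale1r // pnatr_eq0.
have [u2 _] := mulmx1_unit inv2.
rewrite cramerE -?unitfE -?unitmxE //.
have -> : invmx (2 *: invmx (g + 1%:M)) = 2^-1 *: (g + 1%:M).
  by rewrite -[LHS]mulmx1 -[X in _ *m X = _]inv2 mulKmx.
rewrite -scalemxAl -scalemxAr scalerA divff ?pnatr_eq0 // scale1r.
by rewrite mulmxKV.
Qed.

Lemma cayley_inv1 : cayley_inv 1%:M = 0.
Proof. by rewrite /cayley_inv subrr mul0mx. Qed.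

(** A convex condition, so that linear homotopies stay in the domain of the
    Cayley transform; the factor [n + n] is the size of the matrices. *)
Definition entries_small X := forall i j, (n + n)%:R * `|X i j| < 1.

(** Diagonal dominance: if [v = v X], compare the entry of [v] of largest
    modulus with the bound given by this equation. *)
Lemma det_subr_small X : entries_small X -> \det (1%:M - X) != 0.
Proof.
move=> Xs; apply/negP => /det0P[v v0 vX].
have vE : v = v *m X by apply/eqP; rewrite -subr_eq0 -{1}[v]mulmx1 -mulmxBr vX.
have /existsP[i0 vi0] : [exists i, v 0 i != 0].
  apply: contraR v0; rewrite negb_exists => /forallP v0.
  by apply/eqP/rowP => i; rewrite mxE; apply/eqP; rewrite -[_ == _]negbK.
have [i _ imax] := @arg_maxP _ _ _ i0 xpredT (fun i => `|v 0 i|) isT.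
have {}imax j : `|v 0 j| <= `|v 0 i| by exact: imax.
have vi : 0 < `|v 0 i| by rewrite (lt_le_trans _ (imax i0)) ?normr_gt0.
have : `|v 0 i| <= \sum_j `|v 0 i| * `|X j i|.
  rewrite {1}vE mxE (le_trans (ler_norm_sum _ _ _)) //.
  by apply: ler_sum => j _; rewrite normrM ler_wpM2r // imax.
rewrite -mulr_sumr ler_pMr //; apply/negP; rewrite -ltNge.
have n0 : (0 < n + n)%N by case: (n + n)%N i {imax vi} => // -[].
rewrite -(ltr_pM2l (_ : 0 < (n + n)%:R)) ?ltr0n // mulr1 mulr_sumr.
rewrite [ltRHS](_ : _ = \sum_(j < n + n) 1); last by rewrite sumr_const card_ord.
apply: ltr_sum => [|j _]; last exact: Xs.
by apply/hasP; exists i; rewrite ?mem_index_enum.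
Qed.

End Cayley.

(** * Conjugation by a path homotopic to a smooth one *)

Lemma smooth_near_id (R : realType) (t0 : R) : smooth_near (fun t : R => t) t0.
Proof.
suff all t k : derivable (derive1n k (fun t : R => t)) t 1.
  by apply: (filterS (F := nbhs t0) (P := setT)) => //; exact: filterT.
case: k => [|k]; first exact: derivable_id.
have -> : derive1n k.+1 (fun t : R => t) = cst (k == 0%N)%:R.
  elim: k => [|k IH].
    by apply/funext => u; rewrite /= derive1E derive_id.
  by rewrite derive1nS IH; apply/funext => u; rewrite derive1_cst.
exact: derivable_cst.
Qed.

Section CayleyRegular.
Variables (R : realType) (n : nat) (X : Type) (F : set_system X) (x0 : X).
Variable reg : (X -> R) -> Prop.
Hypothesis regP : regular_class F x0 reg.
Implicit Types M : X -> 'M[R]_(n + n).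

Lemma mreg_cayley M :
  mreg reg M -> \det (1%:M - M x0) != 0 -> mreg reg (fun x => cayley (M x)).
Proof.
move=> Mr d0; have cst1 : mreg reg (fun=> 1%:M : 'M[R]_(n + n)).
  exact: (mreg_cst regP).
apply: (mregM regP); first exact: (mregD regP).
apply: (mreg_cramer regP) => //; apply: (mregD regP) => //.
exact: (mregN regP).
Qed.

Lemma mreg_cayley_inv M :
  mreg reg M -> \det (M x0 + 1%:M) != 0 -> mreg reg (fun x => cayley_inv (M x)).
Proof.
move=> Mr d0; apply: (mregM regP).
  by apply: (mregD regP) => //; exact: (mreg_cst regP).
apply: (mreg_cramer regP) => //; apply: (mregD regP) => //.
exact: (mreg_cst regP).
Qed.

End CayleyRegular.

Section Conjugation.
Variables (R : realType) (n : nat).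
Local Notation "''Mat'" := 'M[R]_(n + n).
Implicit Types (phi psi : R -> 'Mat).

Definition graph_values psi : set R :=
  RS_values (@Omegabar R n) 0 1 (fun t => Gr (psi t)) (@Delta R n).

(** The half of the invariance that remains to be proved; the other half is the
    same property for the inverse path. *)
Definition transports_values phi :=
  forall psi, graph_values psi `<=`
    graph_values (fun t => phi t *m psi t *m invmx (phi t)).

Lemma transports_values_eq phi phi' : (forall t, t \in `[0, 1] -> phi t = phi' t) ->
  transports_values phi -> transports_values phi'.
Proof.
move=> e cphi psi mu /cphi; apply: eq_RS_values; first exact: ltr01.
by move=> t t01; rewrite e.
Qed.

Lemma transports_valuesM phi1 phi2 :
  (forall t, t \in `[0, 1] -> Sp (phi1 t)) ->
  (forall t, t \in `[0, 1] -> Sp (phi2 t)) ->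
  transports_values phi1 -> transports_values phi2 ->
  transports_values (fun t => phi1 t *m phi2 t).
Proof.
move=> s1 s2 c1 c2 psi mu /c2/c1; apply: eq_RS_values; first exact: ltr01.
move=> t t01; have [u1 u2] := (Sp_unitmx (s1 t t01), Sp_unitmx (s2 t t01)).
congr Gr; rewrite -!mulmxA; do 3!congr (_ *m _).
have u12 : phi1 t *m phi2 t \in unitmx by rewrite unitmx_mul u1 u2.
by apply: (can_inj (mulKmx u12)); rewrite mulmxV // -!mulmxA mulKVmx // mulmxV.
Qed.

Definition continuous_within (X : topologicalType) (A : set X) (x0 : X)
    (f : X -> R) := f x @[x --> within A (nbhs x0)] --> f x0.

Lemma transports_values_homotopy (h : R * R -> 'Mat)
    (A := `[(0 : R), 1] `*` `[(0 : R), 1]) :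
  (forall x, A x -> Sp (h x)) ->
  (forall x, A x -> mreg (continuous_within A x) h) ->
  (forall t, t \in `[0, 1] ->
     mreg (fun f => smooth_near f t) (fun t => h (1, t))) ->
  (forall s, s \in `[0, 1] -> h (s, 0) = h (0, 0) /\ h (s, 1) = h (0, 1)) ->
  transports_values (fun t => h (0, t)).
Proof.
move=> hS hc hs hends psi mu psimu.
have h0A t : t \in `[0, 1] -> A (0, t).
  by move=> t01; split => //=; rewrite in_itv/= lexx ler01.
have : RS_values (@Omegabar R n) 0 1
    (fun t => diag_act (h (0, t)) @: Gr (psi t))%VS (@Delta R n) mu.
  apply: (@RS_values_transport _ _ (@Omegabar R n) 0 1 ltr01 (@Delta R n)
    (fun x => diag_act (h x)) (fun t => Gr (psi t))) psimu.
  - exact: lagrangian_Delta.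
  - move=> x Ax; have sx := hS x Ax; split; first exact: diag_act_symplectic.
    exact/diag_act_Delta/Sp_unitmx.
  - move=> x0 Ax0; apply: (hreg_diag_act (regular_continuous R Ax0)).
    exact: hc.
  - move=> t t01.
    exact: (hreg_diag_act (regular_smooth setT t) (hs t t01)).
  - by move=> s s01; have [-> ->] := hends s s01.
apply: eq_RS_values; first exact: ltr01.
by move=> t t01; rewrite diag_act_Gr // Sp_unitmx //; apply/hS/h0A.
Qed.

Lemma transports_values_cst (g : 'Mat) : Sp g -> transports_values (fun=> g).
Proof.
move=> sg; apply: (@transports_values_homotopy (fun=> g)) => //.
- by move=> x Ax; exact: (mreg_cst (regular_continuous R Ax)).
- by move=> t _; exact: (mreg_cst (regular_smooth setT t)).
Qed.

Lemma continuous_within_comp (X Y : topologicalType) (A : set X) (B : set Y)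
    (p : X -> Y) x0 (f : Y -> R) :
  (forall x, A x -> B (p x)) -> {for x0, continuous p} ->
  continuous_within B (p x0) f -> continuous_within A x0 (f \o p).
Proof.
move=> AB pc fc; suff pB : p x @[x --> within A (nbhs x0)] --> within B (nbhs (p x0)).
  exact: (cvg_comp p f pB fc).
move=> P BP; change (nbhs x0 (fun x => A x -> P (p x))).
have pBP : nbhs x0 (fun x => B (p x) -> P (p x)) := pc _ BP.
by apply: filterS pBP => x /= Px Ax; exact/Px/AB.
Qed.

(** In the coordinate [X] given by the Cayley transform, the path is joined to
    the segment [t X_1] by a linear homotopy. Its ends are fixed because
    [X_0 = 0]. *)
Lemma transports_values_near1 (g : R -> 'Mat) :
  (forall t, t \in `[0, 1] -> [/\ Sp (g t), \det (g t + 1%:M) != 0 &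
     entries_small (cayley_inv (g t))]) ->
  (forall t, t \in `[0, 1] -> mreg (continuous_within (`[0, 1]%classic : set R) t) g) ->
  g 0 = 1%:M ->
  transports_values g.
Proof.
move=> gP gc g0; pose X t := cayley_inv (g t).
pose Y (x : R * R) := (1 - x.1) *: X x.2 + (x.1 * x.2) *: X 1.
have X0 : X 0 = 0 by rewrite /X g0 cayley_inv1.
pose A := `[(0 : R), 1] `*` `[(0 : R), 1].
have i1 : (1 : R) \in `[0, 1] by rewrite in_itv/= lexx ler01.
have Ysmall x : A x -> entries_small (Y x).
  case: x => s t [/= sI tI] i j; rewrite /Y /=.
  have [-> -> ->] : [/\ ((1 - s) *: X t + (s * t) *: X 1) i j =
      ((1 - s) *: X t) i j + ((s * t) *: X 1) i j,
      ((1 - s) *: X t) i j = (1 - s) * X t i j &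
      ((s * t) *: X 1) i j = s * t * X 1 i j] by split; rewrite mxE.
  have [_ _ st] := gP t tI; have [_ _ s1] := gP 1 i1.
  have {}st := st i j; have {}s1 := s1 i j.
  move: sI tI; rewrite !in_itv/= => /andP[s0 s1'] /andP[t0 t1].
  have le : `|(1 - s) * X t i j + s * t * X 1 i j| <=
      (1 - s) * `|X t i j| + s * `|X 1 i j|.
    rewrite (le_trans (ler_normD _ _)) // !normrM (ger0_norm s0) (ger0_norm t0).
    rewrite (@ger0_norm _ (1 - s)) ?subr_ge0 //.
    rewrite lerD2l; apply: ler_wpM2r => //; exact: ler_piMr.
  have /le_lt_trans := ler_wpM2l (ler0n R (n + n)) le; apply.
  rewrite mulrDr !(mulrCA (n + n)%:R).
  have [->|sn0] := eqVneq s 0; first by rewrite subr0 mul1r mul0r addr0.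
  rewrite [ltRHS](_ : _ = (1 - s) * 1 + s * 1); last by ring.
  apply: ler_ltD; first by apply: ler_wpM2l; rewrite ?subr_ge0 // ltW.
  by rewrite ltr_pM2l // lt_def sn0.
have Yham x : A x -> hamiltonian (Y x).
  case: x => s t [/= sI tI].
  have [st dt _] := gP t tI; have [s1 d1 _] := gP 1 i1.
  by apply: hamiltonianD; apply: hamiltonianZ; exact: hamiltonian_cayley_inv.
apply: (@transports_values_eq (fun t => cayley (Y (0, t)))).
  move=> t tI; rewrite /Y /= subr0 scale1r mul0r scale0r addr0 cayley_invK //.
  by have [] := gP t tI.
apply: (@transports_values_homotopy (fun x => cayley (Y x))).
- by move=> x Ax; apply: Sp_cayley; [exact: Yham | exact/det_subr_small/Ysmall].
- move=> x Ax; have rP := regular_continuous R Ax.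
  apply: (mreg_cayley rP); last exact/det_subr_small/Ysmall.
  have r1 : continuous_within A x fst by apply: cvg_within_filter; exact: cvg_fst.
  have r2 : continuous_within A x snd by apply: cvg_within_filter; exact: cvg_snd.
  have rX : mreg (continuous_within A x) (fun x => X x.2).
    move=> i j; apply: (@continuous_within_comp _ _ A `[(0 : R), 1]%classic snd x
      (fun t => X t i j)); [by move=> y []|exact: cvg_snd|].
    have x2 := Ax.2; have [_ d2 _] := gP _ x2.
    by apply: (mreg_cayley_inv (regular_continuous R x2)) d2 _ _; exact: gc.
  apply: (mregD rP); apply: (mregZ rP) => //; last exact: (mreg_cst rP).
    apply: (regD rP); first exact: (reg_cst rP).
    exact: (regN rP).
  exact: (regM rP).
- move=> t tI; have rP := regular_smooth setT t.
  apply: (mreg_cayley rP); last first.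
    apply/det_subr_small/Ysmall; split => //.
  rewrite (_ : (fun t => Y (1, t)) = fun t => t *: X 1); last first.
    by apply/funext => u; rewrite /Y /= subrr scale0r add0r mul1r.
  apply: (mregZ rP); last exact: (mreg_cst rP).
  exact: smooth_near_id.
- move=> s sI; rewrite /Y /= X0 !scaler0 !mulr0 !scale0r; split=> //.
  by rewrite !mulr1 subr0 scale1r scale0r addr0 -scalerDl subrK scale1r.
Qed.

End Conjugation.

(** * Conjugation by an arbitrary path *)

Section Paths.
Variables (R : realType) (n : nat).
Local Notation "''Mat'" := 'M[R]_(n + n).
Local Notation I01 := (`[(0 : R), 1]%classic : set R).

(** Continuity is expressed entrywise, the form in which it passes to inverses
    and products. *)
Definition regular_Sp_path (phi : R -> 'Mat) :=
  (forall t, I01 t -> Sp (phi t)) /\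
  (forall t, I01 t -> mreg (continuous_within I01 t) phi).

Lemma Sp_path_regular (phi : R -> 'Mat) : Sp_path phi -> regular_Sp_path phi.
Proof.
move=> [/subspace_continuousP phic phiS]; split=> // t tI i j.
apply/cvg_ballP => e e0.
have /cvg_ballP/(_ e e0) := phic t tI.
by apply: filterS => u [_ uP]; exact: uP.
Qed.

Lemma regular_Sp_path_inv (phi : R -> 'Mat) :
  regular_Sp_path phi -> regular_Sp_path (fun t => cramer (phi t)).
Proof.
move=> [phiS phir]; have d t : I01 t -> \det (phi t) != 0.
  by move=> /phiS/Sp_unitmx; rewrite unitmxE unitfE.
split=> t tI; first by rewrite cramerE ?d //; exact/SpV/phiS.
exact: (mreg_cramer (@regular_continuous R R I01 t tI) (phir t tI) (d t tI)).
Qed.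

Lemma continuous_within_clamp (c c' t : R) (f : R -> R) : 0 <= c -> c <= c' -> c' <= 1 ->
  (forall u, I01 u -> continuous_within I01 u f) ->
  continuous_within I01 t (fun u => f (Num.max c (Num.min u c'))).
Proof.
move=> c0 cc' c1 fc.
have clampI u : I01 (Num.max c (Num.min u c')).
  rewrite /= in_itv/= le_max c0 ge_max ge_min c1 orbT (le_trans cc' c1).
  by rewrite andbT.
have clampc : continuous (fun u : R => Num.max c (Num.min u c')).
  apply: (@max_fun_continuous _ R R (fun=> c)); first exact: cst_continuous.
  apply: (@min_fun_continuous _ R R id (fun=> c')); last exact: cst_continuous.
  by move=> v; exact: cvg_id.
by apply: (continuous_within_comp (B := I01)) => //; [exact: clampc | exact: fc].
Qed.

(** The matrix [phi t phi c^-1] is a continuous function of the pair [(t, c)],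
    and equals the identity at [(c0, c0)]. *)
Lemma near_quotient_small (phi : R -> 'Mat) (c0 : R) : regular_Sp_path phi -> I01 c0 ->
  exists2 e : R, 0 < e & forall t c, I01 t -> I01 c ->
    `|c0 - t| < e -> `|c0 - c| < e ->
    let g := phi t *m invmx (phi c) in
    \det (g + 1%:M) != 0 /\ entries_small (cayley_inv g).
Proof.
move=> phiP c0I; have [phiS phir] := phiP.
pose A := I01 `*` I01; have Ac0 : A (c0, c0) by [].
have rP := regular_continuous R Ac0.
have phidet t : I01 t -> \det (phi t) != 0.
  by move=> /phiS/Sp_unitmx; rewrite unitmxE unitfE.
pose G (x : R * R) := phi x.1 *m cramer (phi x.2).
have phipr (p : R * R -> R) : {for (c0, c0), continuous p} -> p (c0, c0) = c0 ->
    (forall x, A x -> I01 (p x)) -> mreg (continuous_within A (c0, c0)) (phi \o p).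
  move=> pc pc0 pI i j.
  apply: (@continuous_within_comp _ _ _ A I01 p (c0, c0) (fun t => phi t i j)) => //.
  by rewrite pc0; exact: phir.
have G_reg : mreg (continuous_within A (c0, c0)) G.
  apply: (mregM rP).
    by apply: (phipr fst) => //; [exact: cvg_fst | move=> x []].
  apply: (mreg_cramer rP); last exact: phidet.
  by apply: (phipr snd) => //; [exact: cvg_snd | move=> x []].
have G0 : G (c0, c0) = 1%:M.
  by rewrite /G cramerE ?mulmxV ?phidet //; exact/Sp_unitmx/phiS.
have det2 : \det (G (c0, c0) + 1%:M) != 0.
  have -> : G (c0, c0) + 1%:M = 2%:M by rewrite G0 -raddfD.
  by rewrite det_scalar expf_neq0 // pnatr_eq0.
have nd : \forall x \near within A (nbhs (c0, c0)), \det (G x + 1%:M) != 0.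
  apply: (near_reg_neq0 rP _ det2); apply: (reg_det rP).
  by apply: (mregD rP) => //; exact: (mreg_cst rP).
have ns : \forall x \near within A (nbhs (c0, c0)), entries_small (cayley_inv (G x)).
  apply: filter_forall => i; apply: filter_forall => j.
  have cr : continuous_within A (c0, c0) (fun x => (n + n)%:R * `|cayley_inv (G x) i j|).
    apply: cvgM; first exact: cvg_cst.
    by apply: cvg_norm; exact: (mreg_cayley_inv rP G_reg det2).
  apply: (cvgr_lt _ cr).
  by rewrite G0 cayley_inv1 mxE normr0 mulr0 ltr01.
have [e /= e0 eP] : nbhs_ball (c0, c0) (fun x => A x ->
    \det (G x + 1%:M) != 0 /\ entries_small (cayley_inv (G x))).
  apply/nbhs_ballP; exact: filterI nd ns.
exists e => // t c tI cI tc0 cc0 /=.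
have := eP (t, c) (conj tc0 cc0) (conj tI cI).
by rewrite /G /= cramerE ?phidet.
Qed.

(** The path stopped at [c'] is the product of the path stopped at [c] and of
    [phi (clamp t) phi c^-1], where [clamp] confines the time to [[c, c']]; the
    latter factor starts at the identity and stays close to it. *)
Lemma transports_values_extend (phi : R -> 'Mat) (c0 : R) : regular_Sp_path phi -> I01 c0 ->
  exists2 e : R, 0 < e & forall c c', I01 c -> I01 c' -> c <= c' ->
    `|c0 - c| < e -> `|c0 - c'| < e ->
    transports_values (fun t => phi (Num.min t c)) ->
    transports_values (fun t => phi (Num.min t c')).
Proof.
move=> phiP c0I; have [phiS phir] := phiP.
have [e e0 eP] := near_quotient_small phiP c0I; exists e => // c c' cI c'I cc'.
move=> cc0 c'c0 cphi.
move: (cI) (c'I); rewrite /= !in_itv/= => /andP[c_ge0 c_le1] /andP[c'_ge0 c'_le1].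
pose clamp t := Num.max c (Num.min t c').
have clamp_le t : c <= clamp t <= c'.
  by rewrite /clamp le_max lexx ge_max cc' ge_min lexx orbT.
have clampI t : I01 (clamp t).
  have /andP[ct tc'] := clamp_le t.
  by rewrite /= in_itv/= (le_trans c_ge0 ct) (le_trans tc' c'_le1).
have min_I t d : I01 t -> I01 d -> I01 (Num.min t d).
  by rewrite /Num.min; case: ifP.
pose g t := phi (clamp t) *m invmx (phi c).
have gS t : Sp (g t) by apply: SpM; [|apply: SpV]; exact: phiS.
have cg : transports_values g.
  apply: transports_values_near1 => [t _|t tI|].
  - have clc0 : `|c0 - clamp t| < e.
      have /andP[ct tc'] := clamp_le t; move: cc0 c'c0.
      by rewrite !ltr_norml => /andP[? ?] /andP[? ?]; apply/andP; split; lra.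
    by have [] := eP (clamp t) c (clampI t) cI clc0 cc0.
  - have rP := @regular_continuous R R I01 t tI; rewrite /g; apply: (mregM rP).
      move=> i j; apply: (@continuous_within_clamp c c' t (fun u => phi u i j)) => //.
      by move=> u uI; exact: phir.
    exact: (mreg_cst rP).
  - have -> : g 0 = phi c *m invmx (phi c).
      rewrite /g; congr (phi _ *m _); rewrite /clamp min_l //.
      exact: max_l.
    by rewrite mulmxV //; exact/Sp_unitmx/phiS.
have := transports_valuesM (fun t _ => gS t) (fun t tI => phiS _ (min_I t c tI cI)) cg cphi.
apply: transports_values_eq => t tI; rewrite /g /clamp.
have uc := Sp_unitmx (phiS c cI).
have [tc|ct] := leP t c.
  by rewrite min_l ?(le_trans tc) // max_l // mulmxV // mul1mx.
by rewrite max_r ?mulmxKV // le_min (ltW ct).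
Qed.

(** The supremum of the times [c] at which [phi] may be stopped is attained and
    equal to [1], since by [transports_values_extend] any such time close below
    the supremum can be pushed beyond it, or up to [1]. *)
Lemma transports_values_path (phi : R -> 'Mat) : regular_Sp_path phi -> transports_values phi.
Proof.
move=> phiP; have [phiS phir] := phiP.
have i0 : I01 0 by rewrite /= in_itv/= lexx ler01.
pose S := [set c | I01 c /\ transports_values (fun t => phi (Num.min t c))].
have S0 : S 0.
  split=> //; apply: (transports_values_eq _ (transports_values_cst (phiS 0 i0))) => t.
  by rewrite in_itv/= => /andP[t0 _]; rewrite min_r.
have S1 : ubound S 1 by move=> c [/= + _]; rewrite in_itv/= => /andP[].
have supS : has_sup S by split; [exists 0 | exists 1].
pose s := sup S.
have sI : I01 s.
  rewrite /= in_itv/=; apply/andP; split; first exact: ub_le_sup supS.2 _ S0.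
  by apply: ge_sup; [exists 0|].
have [e e0 eP] := transports_values_extend phiP sI.
have [c [cI cS] sc] := sup_adherent e0 supS.
have cs : c <= s by apply: ub_le_sup supS.2 _ _.
pose c' := Num.min 1 (s + e / 2).
have sc' : s <= c'.
  move: sI; rewrite /= in_itv/= => /andP[_ s1].
  by rewrite /c' le_min s1 lerDl divr_ge0 // ltW.
have c'I : I01 c'.
  move: sI; rewrite /= !in_itv/= => /andP[s0 _].
  by rewrite (le_trans s0 sc') /c' ge_min lexx.
have c'S : S c'.
  split=> //; apply: eP cS => //; first exact: le_trans sc'.
    by rewrite ger0_norm ?subr_ge0 // ltrBlDr -ltrBlDl.
  rewrite distrC ger0_norm ?subr_ge0 // ltrBlDl.
  rewrite (le_lt_trans (_ : _ <= s + e / 2)) ?ge_min ?lexx ?orbT //.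
  by rewrite ltrD2l ltr_pdivrMr // ltr_pMr // ltr1n.
have c'1 : c' = 1.
  have : c' <= s by exact: ub_le_sup supS.2 _ c'S.
  rewrite /c' /Num.min; case: ifP => // _ ss.
  by exfalso; move: ss e0; lra.
case: c'S; rewrite c'1 => _; apply: transports_values_eq => t.
by rewrite in_itv/= => /andP[_ t1]; rewrite min_l.
Qed.

End Paths.

Theorem proposition48 (R : realType) (n : nat) (psi phi : R -> 'M[R]_(n + n))
  (hpsi : Sp_path psi) (hphi : Sp_path phi) :
  muRS (fun t => phi t *m psi t *m invmx (phi t)) = muRS psi.
Proof.
have phir := Sp_path_regular hphi; have [phiS _] := phir.
rewrite /muRS !muRS_lagrE; congr (xget 0); apply/seteqP; split; last first.
  exact: transports_values_path.
pose psi' t := phi t *m psi t *m invmx (phi t).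
move=> mu /(@transports_values_path _ _ _ (regular_Sp_path_inv phir) psi').
apply: eq_RS_values => [|t tI]; first exact: ltr01.
have u := Sp_unitmx (phiS t tI).
have -> : cramer (phi t) = invmx (phi t) by rewrite cramerE // -unitfE -unitmxE.
by rewrite /psi' invmxK !mulmxA mulVmx // mul1mx -mulmxA mulVmx // mulmx1.
Qed.
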